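(* Let $H=\ell_2(\mathbb{Z})$ over $\mathbb{C}$ with canonical Hilbert basis $(g_l)_{l\in\mathbb{Z}}$, let $A=\frac12(RS+LS)$ where $RS,LS$ are the right and left shifts ($RS\,g_{l}=g_{l+1}$, $LS\,g_{l}=g_{l-1}$), and let $(S_n)_{n\in\mathbb{N}}$ be the $A$-sampling-scale sequence for the shift operator described in the context. Let $\mu$ be the Lebesgue measure on $\mathrm{Borel}([0,1])$ and let $X:[0,1]\to Q$ be $X(t)=\left(\frac{1}{\sqrt2^{\,j}}(e^{2\pi i t})^{l_j}\right)_{j\in\mathbb{N}}$. Then $(S_n)_{n\in\mathbb{N}}$ is convergent, and the resulting measure $\hat\mu$ is the pushforward $\hat\mu=X_{\#}(\mu)$. Furthermore, if $U:H\to L_2([0,1],\mu)$ is given by $U(z)=\hat U(z)\circ X$, then $U$ is an isometry for which, for each $l\in\mathbb{Z}$, $(U(g_l))(t)=e^{2\pi i l t}$ for almost all $t\in[0,1]$. Finally, if $m:[0,1]\to\mathbb{R}$ is given by $m=\hat m\circ X$, then $m(t)=\cos(2\pi t)$ almost everywhere in $[0,1]$, and for any $z\in H$, $U(Az)=m\cdot U(z)$.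
   Context: $\mathbb{N}=\{1,2,\dots\}$; inner products are linear in the first argument. The integer sequence $(l_j)_{j\in\mathbb{N}}$ is $(l_1,l_2,l_3,l_4,l_5,\dots)=(0,1,-1,2,-2,\dots)$. The sequence $S_n=(H_n,A_n,\Omega_n,(e_j^{(n)},c_j^{(n)})_{j=1}^{N_n})$: $H_n=\mathrm{span}(\{g_l\}_{l=-n}^n)$; $A_n=\frac12(RS_n+LS_n)$, where $RS_n,LS_n$ are the linear maps on $H_n$ with $RS_ng_l=g_{l+1}$ for $-n\le l<n$, $RS_ng_n=g_{-n}$, and $LS_n=RS_n^{-1}$; $\Omega_n=\{f_k^{(n)}\}_{k=0}^{2n}$ with $f_k^{(n)}=\frac{1}{\sqrt{2n+1}}\sum_{l=-n}^n e^{-2\pi i l\frac{k}{2n+1}}g_l$ (an orthonormal eigenbasis of $A_n$); $N_n=2n+1$; $e_j^{(n)}=g_{l_j}$ and $c_j^{(n)}=\frac{1}{2^j(1-2^{-N_n})}$ for $1\le j\le 2n+1$. Put $e_j=\lim_n e_j^{(n)}=g_{l_j}$ and $c_j=\lim_n c_j^{(n)}=2^{-j}$. Associated objects: $\mu_n$ is the probability measure on $\Omega_n$ with $\mu_n(\{f\})=\sum_{j=1}^{N_n}c_j^{(n)}|\langle e_j^{(n)},f\rangle|^2$ (which is $>0$); $U_n:H_n\to L_2(\Omega_n,\mu_n)$ is $(U_n(x))(f)=\langle x,f\rangle/\sqrt{\mu_n(\{f\})}$. $Q=\overline{\mathbb{D}}^{\mathbb{N}}$ with the product topology, where $\overline{\mathbb{D}}=\{z\in\mathbb{C}:|z|\le1\}$,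 with coordinate projections $\pi_j$. $X_n:\Omega_n\to Q$ is given by $\pi_j\circ X_n=\sqrt{c_j^{(n)}}\,U_n(e_j^{(n)})$ if $j\le N_n$ and $\pi_j\circ X_n=0$ otherwise. $(S_n)_n$ is convergent if $\left(\int_{\Omega_n}h\circ X_n\,d\mu_n\right)_n$ converges for every continuous $h:Q\to\mathbb{C}$. In that case: $\hat\mu$ is the unique probability measure on $\mathrm{Borel}(Q)$ with $\int_Qh\,d\hat\mu=\lim_n\int_{\Omega_n}(h\circ X_n)\,d\mu_n$ for all continuous $h$; $\hat U:H\to L_2(Q,\hat\mu)$ is the unique linear isometry with $\hat U(e_j)=\frac{1}{\sqrt{c_j}}\pi_j$ for all $j$; and $\hat m$ is the unique real-valued element of $L_2(Q,\hat\mu)$ with $\hat U(Ax)=\hat m\cdot\hat U(x)$ for all $x\in\mathrm{dom}(A)=H$ (existence and uniqueness of $\hat\mu,\hat U,\hat m$ hold for every convergent $A$-sampling-scale sequence). *)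

(* Defs.v *)
From HB Require Import structures.
From mathcomp Require Import all_boot all_order all_algebra.
From mathcomp Require Import complex.
From mathcomp Require Import all_classical all_reals all_analysis.
From mathcomp Require Import ring lra zify.

Set Implicit Arguments.
Unset Strict Implicit.
Unset Printing Implicit Defensive.

Import Order.TTheory GRing.Theory Num.Theory.
Import numFieldNormedType.Exports.
Export numFieldNormedType.Exports.

Local Open Scope classical_set_scope.
Local Open Scope ring_scope.
Local Open Scope complex_scope.

(* The usual topology of the complex numbers: the library attaches the topology
   of a numeric field F to F^o only. *)
HB.instance Definition _ (R : realType) := NormedModule.copy R[i] R[i]^o.

(* The real-valued modulus; `|z| is the same number seen in R[i]. *)
Notation cmod := Normc.normc.

(* exp (i t) *)
Definition expi (R : realType) (t : R) : R[i] := cos t +i* sin t.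

Definition cintegral d (T : measurableType d) (R : realType)
    (mu : {measure set T -> \bar R}) (h : T -> R[i]) : R[i] :=
  (\int[mu]_x complex.Re (h x))%R +i* (\int[mu]_x complex.Im (h x))%R.

(* sum of F l over the integers -n <= l <= n *)
Definition zsum (V : nmodType) (n : nat) (F : int -> V) : V :=
  \sum_(k < n.*2.+1) F (k%:Z - n%:Z).

Section Ell2.
Variable R : realType.

Definition sqsum (x : int -> R[i]) : \bar R :=
  \esum_(l in [set: int]) ((cmod (x l)) ^+ 2)%:E.

Definition ell2_pred : {pred int -> R[i]} := fun x => (sqsum x < +oo)%E.

Lemma cmod_ge0 (z : R[i]) : 0 <= cmod z.
Proof. by case: z => a b /=; exact: sqrtr_ge0. Qed.

Lemma cmod_sqr (z : R[i]) :
  cmod z ^+ 2 = complex.Re z ^+ 2 + complex.Im z ^+ 2.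
Proof. by case: z => a b /=; rewrite sqr_sqrtr// addr_ge0 ?sqr_ge0. Qed.

Lemma normcE (z : R[i]) : `|z| = (cmod z)%:C.
Proof. by case: z. Qed.

Lemma ell2_predP (x : int -> R[i]) (F : int -> R) :
  (forall l, cmod (x l) ^+ 2 <= F l) ->
  (\esum_(l in [set: int]) (F l)%:E < +oo)%E -> x \in ell2_pred.
Proof.
move=> xF; rewrite unfold_in; apply: le_lt_trans.
by apply: le_esum => l _; rewrite lee_fin.
Qed.

Lemma esum_scale_lty (r : R) (F : int -> R) : 0 <= r -> (forall l, 0 <= F l) ->
  (\esum_(l in [set: int]) (F l)%:E < +oo)%E ->
  (\esum_(l in [set: int]) (r * F l)%:E < +oo)%E.
Proof.
move=> r0 F0 Foo.
have Ffin : (\esum_(l in [set: int]) (F l)%:E)%E \is a fin_num.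
  by rewrite ge0_fin_numE//; apply: esum_ge0 => l _; rewrite lee_fin.
apply: (@le_lt_trans _ _ (r%:E * \esum_(l in [set: int]) (F l)%:E)%E); last first.
  by rewrite -(fineK Ffin) -EFinM ltry.
apply: ge_ereal_sup => _ [X XT <-].
under eq_fsbigr do rewrite EFinM.
rewrite -ge0_mule_fsumr; last by move=> l; rewrite lee_fin.
apply: lee_wpmul2l; first by rewrite lee_fin.
by apply: ereal_sup_ubound; exists X.
Qed.

Lemma ell2_submod_closed : submod_closed ell2_pred.
Proof.
split=> [|a x y].
  rewrite unfold_in /sqsum esum1 ?ltry// => l _.
  by rewrite [cmod _]Normc.normc0 expr0n.
rewrite ![_ \in ell2_pred]unfold_in => xo yo.
apply: (@ell2_predP _ (fun l => (2 * cmod a ^+ 2) * cmod (x l) ^+ 2 +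
                                2 * cmod (y l) ^+ 2)).
  move=> l; rewrite !cmod_sqr.
  change ((a *: x + y) l) with (a * x l + y l).
  case: a (x l) (y l) => [a b] [c d] [e f] /=.
  rewrite -subr_ge0.
  have -> : 2 * (a ^+ 2 + b ^+ 2) * (c ^+ 2 + d ^+ 2) + 2 * (e ^+ 2 + f ^+ 2) -
     ((a * c - b * d + e) ^+ 2 + (a * d + b * c + f) ^+ 2) =
     (a * c - b * d - e) ^+ 2 + (a * d + b * c - f) ^+ 2 by ring.
  by rewrite addr_ge0 ?sqr_ge0.
have a0 : 0 <= 2 * cmod a ^+ 2 by apply: mulr_ge0 => //; exact: sqr_ge0.
have sq0 (z : int -> R[i]) l : 0 <= cmod (z l) ^+ 2 by exact: sqr_ge0.
under eq_esum => l _ do rewrite EFinD.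
rewrite esumD.
- by apply: lte_add_pinfty; apply: esum_scale_lty => //; exact: sq0.
- by move=> l _; rewrite lee_fin; apply: mulr_ge0.
- by move=> l _; rewrite lee_fin; apply: mulr_ge0.
Qed.

HB.instance Definition _ :=
  GRing.isSubmodClosed.Build _ _ ell2_pred ell2_submod_closed.

Record ell2 := Ell2 { ell2_val :> int -> R[i]; _ : ell2_val \in ell2_pred }.
HB.instance Definition _ := [isSub for ell2_val].
HB.instance Definition _ := [Choice of ell2 by <:].
HB.instance Definition _ := [SubChoice_isSubLmodule of ell2 by <:].

Definition ell2norm (x : ell2) : R := Num.sqrt (fine (sqsum x)).

(* The series converges absolutely, so its symmetric partial sums have its sum
   as limit. *)
Definition dotl2 (x y : ell2) : R[i] :=
  limn (fun n => zsum n (fun l => x l * (y l)^*)).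

Lemma gvec_subproof (l : int) :
  (fun k => (k == l)%:R : R[i]) \in ell2_pred.
Proof.
rewrite unfold_in /sqsum (esumID [set l]); last by move=> k _; rewrite lee_fin sqr_ge0.
rewrite setTI esum_set1; last by rewrite lee_fin sqr_ge0.
rewrite esum1 ?adde0 ?ltry// => k [_ /= /eqP /negbTE ->].
by rewrite [cmod _]Normc.normc0 expr0n.
Qed.

Definition gvec (l : int) : ell2 := Ell2 (gvec_subproof l).

Lemma translate_subproof (s : int) (x : ell2) :
  (fun l => x (l - s)) \in ell2_pred.
Proof.
case: x => x /= xP; move: (xP); rewrite !unfold_in /sqsum.
rewrite (@reindex_esum _ _ _ [set: int] [set: int] (fun l => l - s))//.
split=> //.
- by move=> a b _ _ /= /addIr.
- by move=> a _; exists (a + s) => //=; rewrite addrK.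
Qed.

Definition RS (x : ell2) : ell2 := Ell2 (translate_subproof 1 x).
Definition LS (x : ell2) : ell2 := Ell2 (translate_subproof (- 1) x).
Definition shiftA (x : ell2) : ell2 := 2^-1 *: (RS x + LS x).

Lemma RS_gvec l : RS (gvec l) = gvec (l + 1).
Proof. by apply: val_inj; apply/funext => k /=; rewrite subr_eq. Qed.

Lemma LS_gvec l : LS (gvec l) = gvec (l - 1).
Proof. by apply: val_inj; apply/funext => k /=; rewrite subr_eq. Qed.

End Ell2.

Section Cube.
Variable R : realType.

Definition closed_disc : set R[i] := [set z | `|z| <= 1].

(* Families indexed by {1, 2, ...} are indexed by nat with a shift: j : nat stands
   for the positive integer j + 1, here and below. *)
Definition Qcube := {ptws nat -> set_type closed_disc}.
HB.instance Definition _ :=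
  Topological.copy Qcube {ptws nat -> set_type closed_disc}.

Definition Qproj (j : nat) (q : Qcube) : R[i] := set_val (q j).

Lemma closed_disc0 : closed_disc 0.
Proof. by rewrite /closed_disc/= normr0. Qed.

Definition in_disc (z : R[i]) (zD : closed_disc z) : set_type closed_disc :=
  exist (fun x => x \in closed_disc) z (mem_set zD).

HB.instance Definition _ := isPointed.Build Qcube (fun=> in_disc closed_disc0).

Definition borelQ := g_sigma_algebraType (@open Qcube).

End Cube.

Section SamplingScale.
Variable R : realType.

Record sampling_scale := SamplingScale {
  ss_space : set (ell2 R) ;
  ss_op : ell2 R -> ell2 R ;     (* relevant on ss_space only *)
  ss_Omega : set (ell2 R) ;
  ss_N : nat ;
  ss_e : nat -> ell2 R ;         (* relevant below ss_N only *)
  ss_c : nat -> R ;              (* relevant below ss_N only *)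
  ss_c_gt0 : forall j, (j < ss_N)%N -> 0 < ss_c j
}.

Variable S : sampling_scale.

Definition mass (f : ell2 R) : R :=
  \sum_(j < ss_N S) ss_c S j * cmod (dotl2 (ss_e S j) f) ^+ 2.

(* The integral over the finite probability space ss_Omega S, whose measure is
   given by the point masses. *)
Definition Omega_integral (h : ell2 R -> R[i]) : R[i] :=
  \sum_(f \in ss_Omega S) h f * (mass f)%:C.

Definition ss_U (x f : ell2 R) : R[i] := dotl2 x f / (Num.sqrt (mass f))%:C.

Definition ss_Xcoord (f : ell2 R) (j : nat) : R[i] :=
  if (j < ss_N S)%N then (Num.sqrt (ss_c S j))%:C * ss_U (ss_e S j) f else 0.

Lemma ss_Xcoord_disc (f : ell2 R) (j : nat) : closed_disc (ss_Xcoord f j).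
Proof.
rewrite /ss_Xcoord; case: ifPn => [jN|_]; last exact: closed_disc0.
rewrite /closed_disc/= /ss_U mulrA normrM normfV.
have c0 k : (k < ss_N S)%N -> 0 <= ss_c S k * cmod (dotl2 (ss_e S k) f) ^+ 2.
  by move=> kN; rewrite mulr_ge0 ?sqr_ge0// ltW// ss_c_gt0.
have m0 : 0 <= mass f by apply: sumr_ge0 => k _; exact: c0.
have [->|mn0] := eqVneq (mass f) 0; first by rewrite sqrtr0 normr0 invr0 mulr0.
have sm0 : 0 < Num.sqrt (mass f) by rewrite sqrtr_gt0 lt_neqAle eq_sym mn0.
have nC (r : R) : 0 <= r -> `|r%:C| = r%:C by move=> r0; rewrite ger0_norm ?lecR.
rewrite nC ?sqrtr_ge0// ler_pdivrMr ?ltcR// mul1r normrM nC ?sqrtr_ge0//.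
rewrite normcE -rmorphM lecR -(ger0_norm (cmod_ge0 _)) -sqrtr_sqr.
rewrite -sqrtrM ?(ltW (ss_c_gt0 _))//; apply: ler_wsqrtr.
rewrite /mass (bigD1 (Ordinal jN))//= lerDl.
by apply: sumr_ge0 => k _; exact: c0.
Qed.

Definition ss_X (f : ell2 R) : Qcube R :=
  fun j => in_disc (ss_Xcoord_disc f j).

End SamplingScale.

Section Limits.
Variables (R : realType) (S : nat -> sampling_scale R).

Definition ss_integral (h : Qcube R -> R[i]) (n : nat) : R[i] :=
  Omega_integral (S n) (h \o ss_X (S n)).

Definition ss_convergent : Prop :=
  forall h : Qcube R -> R[i], continuous h -> cvgn (ss_integral h).

Definition is_limit_measure (muhat : probability (borelQ R) R) : Prop :=
  forall h : Qcube R -> R[i], continuous h ->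
    cintegral muhat h = limn (ss_integral h).

End Limits.

(* Elements of an L2 space are represented by functions; equalities between
   them are stated almost everywhere. *)
Section L2.
Variables (R : realType) (d : measure_display) (T : measurableType d).
Variable mu : {measure set T -> \bar R}.

Definition L2sq (f : T -> R[i]) : \bar R := (\int[mu]_t ((cmod (f t)) ^+ 2)%:E)%E.

Definition in_L2 (f : T -> R[i]) : Prop :=
  [/\ measurable_fun [set: T] (fun t => complex.Re (f t)),
      measurable_fun [set: T] (fun t => complex.Im (f t)) &
      (L2sq f < +oo)%E].

Definition L2norm (f : T -> R[i]) : R := Num.sqrt (fine (L2sq f)).

Definition linear_isometry (U : ell2 R -> T -> R[i]) : Prop :=
  [/\ forall z, in_L2 (U z),
      forall (a : R[i]) (x y : ell2 R),
        {ae mu, forall t, U (a *: x + y) t = a * U x t + U y t} &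
      forall z, L2norm (U z) = ell2norm z].

End L2.

Section Hats.
Variables (R : realType) (muhat : probability (borelQ R) R).

Definition is_Uhat (e : nat -> ell2 R) (c : nat -> R)
    (Uhat : ell2 R -> borelQ R -> R[i]) : Prop :=
  linear_isometry muhat Uhat /\
  forall j, {ae muhat, forall q, Uhat (e j) q = Qproj j q / (Num.sqrt (c j))%:C}.

Definition is_mhat (A : ell2 R -> ell2 R) (Uhat : ell2 R -> borelQ R -> R[i])
    (mhat : borelQ R -> R) : Prop :=
  in_L2 muhat (fun q => (mhat q)%:C) /\
  forall x, {ae muhat, forall q, Uhat (A x) q = (mhat q)%:C * Uhat x q}.

End Hats.

Section Shift.
Variable R : realType.

(* lseq 0, lseq 1, ... is 0, 1, -1, 2, -2, ... *)
Definition lseq (j : nat) : int :=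
  if odd j then (uphalf j)%:Z else - (half j)%:Z.

Definition Hn (n : nat) : set (ell2 R) :=
  range (fun a : int -> R[i] => zsum n (fun l => a l *: gvec R l)).

(* cyclic successor on {-n, ..., n}; RSn_gvec and LSn_gvec below characterize RSn
   and its inverse LSn on the span Hn n *)
Definition cyc (n : nat) (l : int) : int := if l == n%:Z then - n%:Z else l + 1.

Definition RSn (n : nat) (x : ell2 R) : ell2 R :=
  zsum n (fun l => x l *: gvec R (cyc n l)).
Definition LSn (n : nat) (x : ell2 R) : ell2 R :=
  zsum n (fun l => x (cyc n l) *: gvec R l).
Definition An (n : nat) (x : ell2 R) : ell2 R := 2^-1 *: (RSn n x + LSn n x).

Lemma zsum1 (V : nmodType) n (F : int -> V) (l : int) :
  - n%:Z <= l <= n%:Z ->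
  (forall k, - n%:Z <= k <= n%:Z -> k != l -> F k = 0) -> zsum n F = F l.
Proof.
move=> /andP[nl ln] F0.
have ln0 : 0 <= l + n%:Z by lia.
have lt : (`|(l + n%:Z)%R| < n.*2.+1)%N.
  by move: nl ln; lia.
rewrite /zsum (bigD1 (Ordinal lt))//= gez0_abs// addrK big1 ?addr0// => k kl.
apply: F0; last first.
  apply: contra kl => /eqP kl; apply/eqP/val_inj => /=.
  by rewrite -kl subrK absz_nat.
by case: k {kl} => k /= kn; lia.
Qed.

Lemma RSn_gvec n l : - n%:Z <= l <= n%:Z ->
  RSn n (gvec R l) = gvec R (cyc n l).
Proof.
move=> nl; rewrite /RSn (zsum1 nl) => [|k _ /negbTE kl].
  by rewrite /= eqxx scale1r.
by rewrite /= kl scale0r.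
Qed.

Lemma LSn_gvec n l : - n%:Z <= l <= n%:Z ->
  LSn n (gvec R (cyc n l)) = gvec R l.
Proof.
move=> nl; rewrite /LSn (zsum1 nl) => [|k nk kl].
  by rewrite /= eqxx scale1r.
rewrite /=; suff /negbTE -> : cyc n k != cyc n l by rewrite scale0r.
apply: contra kl; move: nl nk; rewrite /cyc.
by case: (eqVneq k n%:Z) => [->|kn]; case: (eqVneq l n%:Z) => [->|ln] //; lia.
Qed.

Definition fvec (n k : nat) : ell2 R :=
  (Num.sqrt n.*2.+1%:R)^-1%:C *:
    zsum n (fun l => expi (- (2 * pi * l%:~R * (k%:R / n.*2.+1%:R))) *: gvec R l).

Definition cn (n j : nat) : R := (2 ^+ j.+1 * (1 - 2 ^- n.*2.+1))^-1.

Lemma cn_gt0 n j : 0 < cn n j.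
Proof.
rewrite /cn invr_gt0 mulr_gt0 ?exprn_gt0// subr_gt0 invf_lt1 ?exprn_gt0//.
by rewrite exprn_egt1// ltr1n.
Qed.

Definition shift_scale (n : nat) : sampling_scale R := {|
  ss_space := Hn n ;
  ss_op := An n ;
  ss_Omega := [set fvec n k | k in `I_(n.*2.+1)] ;
  ss_N := n.*2.+1 ;
  ss_e := fun j => gvec R (lseq j) ;
  ss_c := cn n ;
  ss_c_gt0 := fun j _ => cn_gt0 n j |}.

(* starts at n = 1 *)
Definition shift_seq (n : nat) : sampling_scale R := shift_scale n.+1.

Definition e_lim (j : nat) : ell2 R := gvec R (lseq j).
Definition c_lim (j : nat) : R := 2 ^- j.+1.

(* Functions on [0,1] are represented by functions on R; the complement of [0,1]
   is negligible for this measure. *)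
Definition lebesgue01 : {measure set (measurableTypeR R) -> \bar R} :=
  mrestr (@lebesgue_measure R) (measurable_itv `[0%R, 1%R]).

Definition Xcoord (t : R) (j : nat) : R[i] :=
  ((Num.sqrt 2 ^+ j.+1)^-1)%:C * expi (2 * pi * t) ^ lseq j.

Lemma Xcoord_disc (t : R) (j : nat) : closed_disc (Xcoord t j).
Proof.
have n1 : `|expi (2 * pi * t)| = 1 :> R[i].
  by rewrite normcE /= cos2Dsin2 sqrtr1.
have nz1 (l : int) : `|expi (2 * pi * t) ^ l| = 1.
  by case: l => k; rewrite ?NegzE -?exprnN ?normfV ?normrX n1 expr1n ?invr1.
rewrite /closed_disc/= /Xcoord normrM nz1 mulr1 normcE /= expr0n/= addr0 sqrtr_sqr lecR.
rewrite ger0_norm ?invr_ge0 ?exprn_ge0 ?sqrtr_ge0// invf_le1 ?exprn_gt0 ?sqrtr_gt0//.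
by rewrite exprn_ege1// -[leLHS]sqrtr1 ler_wsqrtr// ler1n.
Qed.

Definition Xmap (t : R) : borelQ R :=
  fun j => in_disc (Xcoord_disc t j).

End Shift.

(* Main.v *)
(** The masses of the sampling points are all equal to [1/N], [N = 2n+1], and the
    [j]-th coordinate of [X_n] at the [k]-th one is
    [sqrt c_j^(n) * exp (2 pi i l_j k / N)].  The integrals against [mu_n] are
    therefore integrals over [0,1] of step functions that converge pointwise to
    [h o X], by mere continuity of [h] at [X t]; dominated convergence (the cube
    is compact, so [h] is bounded) gives convergence to [int h o X].  A limit
    measure is then the law of [X], because indicators of open subsets of the
    cube are pointwise limits of continuous functions.
    The functions [w_j = pi_j / sqrt c_j] become [exp (2 pi i l_j t)] after
    composition with [X]; they are orthonormal, so the isometry is the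
    Riesz-Fischer series with respect to them.  That [A] acts as multiplication by
    [Re w_1], which is [cos (2 pi t)], is an addition formula on the basis vectors
    and extends to the whole space by density. *)

Require Import Defs.
From HB Require Import structures.
From mathcomp Require Import all_boot all_order all_algebra.
From mathcomp Require Import complex.
From mathcomp Require Import all_classical all_reals all_analysis.
From mathcomp Require Import measurable_realfun.
From mathcomp Require Import ring lra zify.

Set Implicit Arguments.
Unset Strict Implicit.
Unset Printing Implicit Defensive.

Import Order.TTheory GRing.Theory Num.Theory.
Import numFieldNormedType.Exports.

Local Open Scope classical_set_scope.
Local Open Scope ring_scope.
Local Open Scope complex_scope.

(** * Topology of the complex numbers and of the cube *)

(** Elements of L2 are plain functions here, so identities between them hold only almost everywhere,
    and the isometry is chosen vector by vector. Linearity of [Uhat], the multiplication rule and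
    the transfer of identities from $[0,1]$ to the cube are therefore all proved in one way: the
    squared L2 norm of a defect is shown to vanish. The estimates rest on
    $|z+y|^2\le(1+e)|z|^2+(1+e^{-1})|y|^2$, which passes through integrals with values in the
    extended reals and becomes sharp as $e\to0$. Integrals of products occur only for the $w_j$,
    which are bounded.

    Null sets pull back along [Xmap] for free, but the way back to the cube is restricted to
    equalities of measurable functions.

    The sigma-algebra of the cube is generated by its open sets, not by cylinders. The law of [Xmap]
    is therefore identified through continuous functions that see finitely many coordinates, the
    number of coordinates growing together with their steepness. *)

Section ComplexTopology.
Variable R : realType.
Implicit Types z : R[i].

Lemma cmod_le z : cmod z <= `|complex.Re z| + `|complex.Im z|.
Proof.
rewrite -(ger0_norm (cmod_ge0 z)) -[leRHS]ger0_norm ?addr_ge0//.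
rewrite -ler_sqr ?nnegrE// !real_normK ?num_real// cmod_sqr sqrrD !real_normK ?num_real//.
by rewrite addrAC lerDl mulrn_wge0// mulr_ge0.
Qed.

Lemma Re_le_cmod z : `|complex.Re z| <= cmod z.
Proof. by rewrite -lecR -Defs.normcE normc_ge_Re. Qed.

Lemma Im_le_cmod z : `|complex.Im z| <= cmod z.
Proof.
rewrite -[leRHS](ger0_norm (cmod_ge0 z)) -ler_sqr ?nnegrE//.
by rewrite !real_normK ?num_real// cmod_sqr lerDr sqr_ge0.
Qed.

Lemma ReB (z y : R[i]) : complex.Re (z - y) = complex.Re z - complex.Re y.
Proof. by case: z y => [a b] [c d]. Qed.

Lemma ImB (z y : R[i]) : complex.Im (z - y) = complex.Im z - complex.Im y.
Proof. by case: z y => [a b] [c d]. Qed.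

Lemma cvg_complex (T : Type) (F : set_system T) (FF : Filter F)
    (f : T -> R[i]) (l : R[i]) :
  complex.Re (f x) @[x --> F] --> complex.Re l ->
  complex.Im (f x) @[x --> F] --> complex.Im l ->
  f x @[x --> F] --> l.
Proof.
move=> /cvgrPdist_lt fr /cvgrPdist_lt fi; apply/cvgrPdist_lt => e e0.
(* The norm of [R[i]] has values in [R[i]], so [e] is itself a complex number; being positive, it
   has imaginary part zero. *)
have eE : e = (complex.Re e)%:C.
  by apply/eqP; rewrite eq_complex/= eqxx; case: e e0 => a b; rewrite ltcE/= => /andP[].
have re0 : 0 < complex.Re e by rewrite eE ltcR in e0.
near=> x; rewrite Defs.normcE eE ltcR (le_lt_trans (cmod_le _))//.
rewrite (splitr (complex.Re e)) ltrD//.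
  by rewrite ReB; near: x; apply: fr; rewrite divr_gt0.
by rewrite ImB; near: x; apply: fi; rewrite divr_gt0.
Unshelve. all: by end_near. Qed.

Lemma cvg_Re (T : Type) (F : set_system T) (FF : Filter F)
    (f : T -> R[i]) (l : R[i]) :
  f x @[x --> F] --> l -> complex.Re (f x) @[x --> F] --> complex.Re l.
Proof.
move=> /cvgrPdist_lt fl; apply/cvgrPdist_lt => e e0; near=> x.
rewrite -ReB (le_lt_trans (Re_le_cmod _))// -ltcR -Defs.normcE; near: x.
by apply: (fl e%:C); rewrite ltcR.
Unshelve. all: by end_near. Qed.

Lemma Re_continuous : continuous (@complex.Re R).
Proof. by move=> z; apply: (@cvg_Re _ _ (nbhs_filter z) idfun z); exact: cvg_id. Qed.

Lemma cvg_Im (T : Type) (F : set_system T) (FF : Filter F)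
    (f : T -> R[i]) (l : R[i]) :
  f x @[x --> F] --> l -> complex.Im (f x) @[x --> F] --> complex.Im l.
Proof.
move=> /cvgrPdist_lt fl; apply/cvgrPdist_lt => e e0; near=> x.
rewrite -ImB (le_lt_trans (Im_le_cmod _))// -ltcR -Defs.normcE; near: x.
by apply: (fl e%:C); rewrite ltcR.
Unshelve. all: by end_near. Qed.

Lemma Im_continuous : continuous (@complex.Im R).
Proof. by move=> z; apply: (@cvg_Im _ _ (nbhs_filter z) idfun z); exact: cvg_id. Qed.

Lemma cvg_cmod (T : Type) (F : set_system T) (FF : Filter F)
    (f : T -> R[i]) (l : R[i]) :
  f x @[x --> F] --> l -> cmod (f x) @[x --> F] --> cmod l.
Proof.
move=> fl; have cmodE (z : R[i]) :
    cmod z = Num.sqrt (complex.Re z * complex.Re z + complex.Im z * complex.Im z).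
  by rewrite -!expr2 -cmod_sqr sqrtr_sqr ger0_norm// cmod_ge0.
under eq_fun do rewrite cmodE.
rewrite cmodE.
apply: (@cvg_comp _ _ _ _ (@Num.sqrt R) F _ _ _ (@sqrt_continuous R _)).
by apply: cvgD; apply: cvgM; (exact: cvg_Re || exact: cvg_Im).
Qed.

Lemma cmod_continuous : continuous (@Normc.normc R).
Proof. by move=> z; apply: (@cvg_cmod _ _ (nbhs_filter z) idfun z); exact: cvg_id. Qed.

Lemma complex_hausdorff : hausdorff_space R[i].
Proof. exact: norm_hausdorff. Qed.

Lemma closed_discE z : closed_disc z = (cmod z <= 1).
Proof. by rewrite -lecR -Defs.normcE. Qed.

(** The disc is closed and lies in the continuous image of the compact square $[-1,1]^2$. *)
Lemma compact_closed_disc : compact (@closed_disc R).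
Proof.
pose g (p : R * R) : R[i] := p.1 +i* p.2.
have cg : continuous g.
  by move=> p; apply: cvg_complex => /=; [exact: cvg_fst|exact: cvg_snd].
apply: (@subclosed_compact _ _ (g @` (`[-1, 1] `*` `[-1, 1]))).
- have -> : @closed_disc R = @Normc.normc R @^-1` [set x | x <= 1].
    by apply/funext => z; exact: closed_discE.
  by apply: preimage_closed; [by move=> z _; exact: cmod_continuous|exact: closed_le].
- apply: continuous_compact; first exact: continuous_subspaceT.
  by apply: compact_setX; exact: segment_compact.
- move=> z; rewrite closed_discE => z1.
  exists (complex.Re z, complex.Im z); last by case: z z1.
  by split; rewrite /= in_itv/= -ler_norml (le_trans _ z1)// ?Re_le_cmod ?Im_le_cmod.
Qed.

End ComplexTopology.

(** The factors of the cube are subtypes, so Tychonoff's theorem asks for their compactness as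
    spaces. A filter on the subtype is pushed along the inclusion, and its cluster point in [A] is
    lifted back. *)
Lemma compact_set_type (X : topologicalType) (A : set X) :
  compact A -> compact [set: set_type A].
Proof.
move=> cA F PF FT.
have FA : (set_val @ F) A.
  by apply: (@filterS _ F _ setT _ _ FT); case=> x xA _; exact: set_mem xA.
have [p [Ap clp]] := cA (set_val @ F) _ FA.
exists (exist (fun x => x \in A) p (mem_set Ap)); split => //.
move=> U V FU [_ [[W oW <-] /= Wp WV]].
have [|x [Ux Wx]] := clp (set_val @` U) W _ (open_nbhs_nbhs (conj oW Wp)).
  by apply: (@filterS _ F _ U _ _ FU) => u Uu; exists u.
by case: Ux Wx => u Uu <- Wu; exists u; split => //; exact: WV.
Qed.

Section CubeTopology.
Variable R : realType.

Lemma cvg_Qcube (T : Type) (F : set_system T) (FF : Filter F)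
    (f : T -> Qcube R) (q : Qcube R) :
  (forall j, Qproj j (f x) @[x --> F] --> Qproj j q) -> f x @[x --> F] --> q.
Proof.
(* The product topology is a supremum of initial topologies, and each factor carries an initial
   topology too, whence the two layers of preimages [W] and [W']. *)
move=> fq; apply/cvg_sup => j U [V] [[W [W' oW' <-] <-]] Wq VU.
have FW : F [set x | W' (Qproj j (f x))] by exact: fq (open_nbhs_nbhs (conj oW' Wq)).
by apply: (@filterS _ F _ _ _ _ FW) => x Wx; exact: VU.
Qed.

Lemma Qproj_continuous j : continuous (@Qproj R j).
Proof.
move=> q; apply: (@continuous_comp _ _ _ (fun q : Qcube R => q j) set_val).
  exact: (@proj_continuous nat (fun=> set_type (@closed_disc R)) j q).
exact: initial_continuous.
Qed.

Lemma Qproj_le1 j (q : Qcube R) : cmod (Qproj j q) <= 1.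
Proof. by rewrite -closed_discE /Qproj; case: (q j) => x xA; exact: set_mem xA. Qed.

Lemma compact_Qcube : compact [set: Qcube R].
Proof.
have := @tychonoff nat (fun=> set_type (@closed_disc R)) (fun=> setT)
  (fun=> compact_set_type (@compact_closed_disc R)).
by congr compact; apply/seteqP; split.
Qed.

Lemma bounded_Qcube (h : Qcube R -> R) : continuous h ->
  exists M, 0 < M /\ forall q, `|h q| <= M.
Proof.
move=> ch; have /compact_bounded : compact (h @` [set: Qcube R]).
  by apply: continuous_compact compact_Qcube; exact: continuous_subspaceT.
move=> [M [_ hM]]; exists (`|M| + 1); split; first by rewrite ltr_wpDl.
by move=> q; apply: hM; [rewrite (le_lt_trans (ler_norm _))// ltrDl|exists q].
Qed.

Lemma measurable_continuous_borelQ (h : Qcube R -> R) :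
  continuous h -> measurable_fun [set: borelQ R] (h : borelQ R -> R).
Proof.
move=> ch; apply: (measurability _ (RGenOInfty.measurableE R)) => _ [_ [x ->] <-].
rewrite setTI; apply: sub_sigma_algebra.
by apply: open_comp => // ? _; exact: ch.
Qed.

End CubeTopology.

(** * The curve [X] *)

Section ExpI.
Variable R : realType.

Lemma expi0 : expi (0 : R) = 1.
Proof. by rewrite /expi cos0 sin0. Qed.

Lemma expiD (a b : R) : expi (a + b) = expi a * expi b.
Proof.
rewrite /expi cosD sinD; apply/eqP; rewrite eq_complex/=.
by apply/andP; split; apply/eqP; ring.
Qed.

Lemma expi_conj (a : R) : (expi a)^* = expi (- a).
Proof. by rewrite /expi cosN sinN. Qed.

Lemma expiV (a : R) : (expi a)^-1 = expi (- a).
Proof.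
apply: (@mulfI _ (expi a)).
  by apply/eqP => /(congr1 (fun z => z * expi (- a))); rewrite mul0r -expiD subrr expi0 => /eqP; rewrite oner_eq0.
rewrite -expiD subrr expi0 mulfV//.
by apply/eqP => /(congr1 (fun z => z * expi (- a))); rewrite mul0r -expiD subrr expi0 => /eqP; rewrite oner_eq0.
Qed.

Lemma expiXn (a : R) (n : nat) : expi a ^+ n = expi (n%:R * a).
Proof.
elim: n => [|n IH]; first by rewrite expr0 mul0r expi0.
by rewrite exprS IH -expiD mulrS mulrDl mul1r.
Qed.

Lemma expiX (a : R) (l : int) : expi a ^ l = expi (l%:~R * a).
Proof.
case: l => n; first by rewrite -exprnP expiXn -pmulrn.
by rewrite NegzE -exprnN expiXn expiV rmorphN/= mulNr -pmulrn.
Qed.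

Lemma cmod_expi (a : R) : cmod (expi a) = 1.
Proof. by rewrite /= cos2Dsin2 sqrtr1. Qed.

(** With $\theta=(a-b)/2$ in $(0,\pi)$, equality would give $1=\cos 2\theta=1-2\sin^2\theta$, while
    $\sin\theta>0$. *)
Lemma expi_inj (a b : R) : `|a - b| < 2 * pi -> expi a = expi b -> a = b.
Proof.
wlog ab : a b / b <= a.
  move=> H ablt eab; have [ba|/ltW ab] := leP b a; first exact: H.
  by apply/esym/H; rewrite // distrC.
move=> ablt eab; apply/eqP; rewrite -subr_eq0; apply: contraTT isT => abn0.
have ab0 : 0 < a - b by rewrite lt_def abn0 subr_ge0.
rewrite gtr0_norm// in ablt.
have : expi (a - b) = 1 by rewrite expiD eab -expiD subrr expi0.
rewrite /expi => -[+ _]; rewrite (_ : a - b = ((a - b) / 2) *+ 2); last first.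
  by rewrite -mulr_natr mulfVK.
rewrite cos_mulr2n cos2sin2 => h.
suff : 0 < sin ((a - b) / 2) by nra.
by apply: sin_gt0_pi; rewrite divr_gt0//= ltr_pdivrMr// mulrC.
Qed.

Lemma Re_realM (r : R) (z : R[i]) : complex.Re (r%:C * z) = r * complex.Re z.
Proof. by case: z => a b /=; rewrite mul0r subr0. Qed.

Lemma Im_realM (r : R) (z : R[i]) : complex.Im (r%:C * z) = r * complex.Im z.
Proof. by case: z => a b /=; rewrite mul0r addr0. Qed.

Lemma cvg_realM_expi (T : Type) (F : set_system T) (FF : Filter F)
    (r a : T -> R) (r0 a0 : R) :
  r x @[x --> F] --> r0 -> a x @[x --> F] --> a0 ->
  (r x)%:C * expi (a x) @[x --> F] --> r0%:C * expi a0.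
Proof.
move=> rr aa; apply: cvg_complex.
  rewrite Re_realM; under eq_fun do rewrite Re_realM.
  by apply: cvgM => //; apply: (@cvg_comp _ _ _ _ (@cos R) F _ _ aa (@continuous_cos R a0)).
rewrite Im_realM; under eq_fun do rewrite Im_realM.
by apply: cvgM => //; apply: (@cvg_comp _ _ _ _ (@sin R) F _ _ aa (@continuous_sin R a0)).
Qed.

End ExpI.

Section XmapTheory.
Variable R : realType.

Lemma Qproj_Xmap (t : R) j :
  Qproj j (Xmap t) = ((Num.sqrt 2 ^+ j.+1)^-1)%:C * expi (2 * pi * (lseq j)%:~R * t).
Proof.
rewrite -[LHS]/(Xcoord t j) /Xcoord expiX; congr (_ * expi _); ring.
Qed.

Lemma Xmap_continuous : continuous (@Xmap R : R -> Qcube R).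
Proof.
move=> t; apply: cvg_Qcube => j; under eq_fun do rewrite Qproj_Xmap.
rewrite Qproj_Xmap; apply: cvg_realM_expi; first exact: cvg_cst.
by apply: cvgM; [exact: cvg_cst|exact: cvg_id].
Qed.

Lemma measurable_Xmap : measurable_fun [set: measurableTypeR R] (@Xmap R).
Proof.
refine (@measurability _ _ (measurableTypeR R) (borelQ R) setT (@Xmap R)
  (@open (Qcube R)) erefl _).
move=> _ [U oU <-]; rewrite setTI; apply: open_measurable.
by move/continuousP : Xmap_continuous; apply.
Qed.

Lemma lebesgue01T : lebesgue01 R setT = 1%E.
Proof.
rewrite /lebesgue01/= /mrestr setTI lebesgue_measure_itv/= lte_fin ltr01.
by rewrite oppr0 adde0.
Qed.

(** The endpoint 1 is a null set. Dropping it leaves exactly the interval that the half-open cells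
    of a sampling grid partition. *)
Lemma lebesgue01_ae (P : R -> Prop) :
  (forall t, 0 <= t < 1 -> P t) -> {ae lebesgue01 R, forall t, P t}.
Proof.
move=> H; exists (~` `[0, 1[%classic); split; first exact: measurableC.
- rewrite /lebesgue01/= /mrestr.
  have -> : ~` `[0, 1[%classic `&` `[0, 1]%classic = [set (1 : R)].
    apply/seteqP; split => x /=; rewrite !in_itv/=.
      move=> [/negP + /andP[x0 x1]]; rewrite x0/= -leNgt => h.
      by apply/eqP; rewrite eq_le x1.
    by move=> ->; rewrite ltxx ler01 lexx; split.
  exact: lebesgue_measure_set1.
- move=> x /= nP; rewrite in_itv/= => /H; exact: nP.
Qed.

Lemma integral_lebesgue01 (f : R -> \bar R) :
  measurable_fun [set: R] f ->
  (\int[lebesgue01 R]_t f t = \int[lebesgue_measure]_(t in `[0%R, 1%R]) f t)%E.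
Proof.
move=> mf; transitivity (\int[lebesgue01 R]_(t in `[0%R, 1%R]) f t)%E.
  rewrite -(setIT `[0%R : R, 1%R]%classic) integral_mkcondl; apply: ae_eq_integral => //.
    apply/(measurable_restrictT _ _).1 => //; exact: measurable_funTS.
  apply: lebesgue01_ae => t /andP[t0 t1] _; rewrite patchE mem_set//=.
  by rewrite in_itv/= t0 ltW.
apply: eq_measure_integral => A mA AD.
by rewrite /lebesgue01/= /mrestr setIidl.
Qed.

End XmapTheory.

(** * The sampling scales *)

Section ShiftScale.
Variable R : realType.
Implicit Types (n k j : nat) (l : int).

Lemma ell2ZE (a : R[i]) (x : ell2 R) l : (a *: x) l = a * x l.
Proof. by []. Qed.

Lemma ell2_zsumE n (c : int -> R[i]) (v : int -> ell2 R) l :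
  zsum n (fun i => c i *: v i) l = zsum n (fun i => c i * v i l).
Proof.
by rewrite /zsum (big_morph (fun x : ell2 R => x l) (id1 := 0) (op1 := +%R)).
Qed.

Lemma fvecE n k l : - n%:Z <= l <= n%:Z ->
  fvec R n k l = ((Num.sqrt n.*2.+1%:R)^-1)%:C *
                 expi (- (2 * pi * l%:~R * (k%:R / n.*2.+1%:R))).
Proof.
move=> nl; rewrite /fvec.
rewrite ell2ZE; congr (_ * _); rewrite ell2_zsumE (zsum1 nl) => [|i _ il]; first by rewrite /= eqxx mulr1.
by rewrite /= eq_sym (negbTE il) mulr0.
Qed.

(** The symmetric partial sums are constant from index $|l|$ on. The conjugate appears because the
    inner product is linear in its first argument. *)
Lemma dotl2_gvec l (f : ell2 R) : dotl2 (gvec R l) f = (f l)^*.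
Proof.
apply: cvg_lim; first exact: complex_hausdorff.
apply: cvg_near_cst; exists `|l|%N => // m /= lm.
rewrite (@zsum1 _ m _ l) => [|| i _ il].
- by rewrite /= eqxx mul1r.
- by move: lm; lia.
- by rewrite /= (negbTE il) mul0r.
Qed.

Lemma lseq_bound n j : (j < n.*2.+1)%N -> - n%:Z <= lseq j <= n%:Z.
Proof.
by move=> jn; rewrite /lseq; have := odd_double_half j; rewrite uphalf_half; case: (odd j) => /=; lia.
Qed.

Lemma dotl2_gvec_fvec n k l : - n%:Z <= l <= n%:Z ->
  dotl2 (gvec R l) (fvec R n k) =
  ((Num.sqrt n.*2.+1%:R)^-1)%:C * expi (2 * pi * l%:~R * (k%:R / n.*2.+1%:R)).
Proof.
move=> nl; rewrite dotl2_gvec fvecE// rmorphM/= -[X in _ * X]/((expi _)^*) expi_conj opprK.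
by congr (_ * _); rewrite /= oppr0.
Qed.

Lemma cmod_real (r : R) : cmod r%:C = `|r|.
Proof. by rewrite /= expr0n/= addr0 sqrtr_sqr. Qed.

Lemma cmodM (z w : R[i]) : cmod (z * w) = cmod z * cmod w.
Proof. exact: Normc.normcM. Qed.

Lemma sum_geo_half n : \sum_(j < n) (2 ^+ j.+1 : R)^-1 = 1 - 2 ^- n.
Proof.
elim: n => [|n IH]; first by rewrite big_ord0 expr0 invr1 subrr.
rewrite big_ord_recr/= IH exprS invfM.
by move: (2 ^- n) => x; lra.
Qed.

(** All overlaps $|\langle g_l,f_k\rangle|^2$ with $|l|\le n$ equal $1/N$, so the mass is $1/N$
    times the sum of the weights. The factor $1-2^{-N}$ in [cn] normalizes that sum to 1. *)
Lemma mass_fvec n k : mass (shift_scale R n) (fvec R n k) = n.*2.+1%:R^-1.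
Proof.
rewrite /mass/=.
under eq_bigr => j _.
  rewrite dotl2_gvec_fvec ?lseq_bound// cmodM cmod_real cmod_expi mulr1.
  rewrite ger0_norm ?invr_ge0 ?sqrtr_ge0// exprVn sqr_sqrtr ?ler0n// /cn invfM.
  over.
rewrite -!mulr_suml sum_geo_half divff ?mul1r//.
by rewrite lt0r_neq0// subr_gt0 invf_lt1 ?exprn_gt0// exprn_egt1// ltr1n.
Qed.

(** The factor $1/\sqrt N$ of the Fourier vector cancels against the square root of the mass in
    [ss_U], leaving a pure phase. *)
Lemma Qproj_ss_X n k j : (j < n.*2.+1)%N ->
  Qproj j (ss_X (shift_scale R n) (fvec R n k)) =
  (Num.sqrt (cn R n j))%:C * expi (2 * pi * (lseq j)%:~R * (k%:R / n.*2.+1%:R)).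
Proof.
move=> jn; rewrite -[LHS]/(ss_Xcoord _ _ _) /ss_Xcoord/= jn.
rewrite /ss_U mass_fvec dotl2_gvec_fvec ?lseq_bound//.
congr (_ * _); rewrite sqrtrV ?ler0n// mulrAC.
by rewrite mulfV ?mul1r// fmorph_eq0 invr_eq0 sqrtr_eq0 -ltNge ltr0n.
Qed.

(** [ss_Omega] is a set, so a sum over it becomes a sum over [k] only if the vectors are distinct.
    The coordinate at 1, within range because $0<n$, separates them: its phases differ by less than
    $2\pi$. *)
Lemma fvec_inj n : (0 < n)%N -> {in `I_(n.*2.+1) &, injective (fvec R n)}.
Proof.
move=> n0 k1 k2; rewrite !inE/= => k1n k2n /(congr1 (fun f : ell2 R => f 1)).
rewrite !fvecE; [|lia..].
have sn : (Num.sqrt (n.*2.+1%:R : R))^-1 != 0.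
  by rewrite invr_eq0 sqrtr_eq0 -ltNge ltr0n.
have snC : ((Num.sqrt (n.*2.+1%:R : R))^-1)%:C != 0 by rewrite fmorph_eq0.
move/(mulfI snC) => e; apply/eqP; rewrite -(eqr_nat R).
have N0 : 0 < n.*2.+1%:R :> R by rewrite ltr0n.
suff : - (2 * pi * 1%:~R * (k1%:R / n.*2.+1%:R)) = - (2 * pi * 1%:~R * (k2%:R / n.*2.+1%:R)) :> R.
  have p0 : 2 * pi * 1%:~R != 0 :> R by rewrite mulr1 mulf_neq0// gt_eqF// pi_gt0.
  have N1 : n.*2.+1%:R^-1 != 0 :> R by rewrite invr_eq0 gt_eqF.
  by move/oppr_inj/(mulfI p0)/(mulIf N1) => ->.
apply: expi_inj e.
rewrite -opprD normrN mulr1 -mulrBr -mulrBl !normrM.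
rewrite [`|2|]ger0_norm// [`|pi|]ger0_norm ?pi_ge0// -[ltRHS]mulr1.
rewrite ltr_pM2l ?mulr_gt0 ?pi_gt0//.
rewrite [`|_^-1|]ger0_norm ?invr_ge0 ?ltW// ltr_pdivrMr// mul1r.
move: k1n k2n; rewrite -(ltr_nat R) -(ltr_nat R k2) => k1n k2n.
move: (ler0n R k1) (ler0n R k2) k1n k2n; move: (n.*2.+1%:R) (k1%:R) (k2%:R) => N a b.
by move=> a0 b0 aN bN; rewrite ltr_norml; apply/andP; split; lra.
Qed.

Lemma Omega_integral_shift n (h : ell2 R -> R[i]) : (0 < n)%N ->
  Omega_integral (shift_scale R n) h =
  \sum_(k < n.*2.+1) h (fvec R n k) * (n.*2.+1%:R^-1)%:C.
Proof.
move=> n0; rewrite /Omega_integral/=.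
rewrite (@reindex_fsbig _ _ _ _ _ (fvec R n) `I_(n.*2.+1)).
  by rewrite (fsbig_ord _ _ (fun k => h (fvec R n k) * (n.*2.+1%:R^-1)%:C));
    apply: eq_fsbigr => k _; rewrite mass_fvec.
by split; [move=> k kn; exists k|exact: fvec_inj|move=> _ [k kn <-]; exists k].
Qed.

End ShiftScale.

(** * Riemann sums and convergence *)

Section RiemannSums.
Variable R : realType.

(** Each sample is spread over a cell whose length is its mass $1/N$, with the sampling point as
    left end. *)
Definition step_fun (N : nat) (a : nat -> R) (t : R) : R :=
  \sum_(k < N) a k * \1_(`[k%:R / N%:R, k.+1%:R / N%:R[%classic) t.

Lemma measurable_step_fun N a : measurable_fun [set: R] (step_fun N a).
Proof.
apply: measurable_sum => k; apply: measurable_funM; first exact: measurable_cst.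
exact: measurable_indic.
Qed.

Lemma step_funE N a (t : R) : (0 < N)%N -> 0 <= t < 1 ->
  exists k, [/\ (k < N)%N, step_fun N a t = a k & `|t - k%:R / N%:R| <= N%:R^-1].
Proof.
move=> N0 /andP[t0 t1]; have N0' : 0 < N%:R :> R by rewrite ltr0n.
have Nt0 : 0 <= N%:R * t by rewrite mulr_ge0// ltW.
have /andP[kt tk] := truncn_itv Nt0.
(* The cell containing [t] has index $\lfloor Nt\rfloor$. *)
set k := Num.truncn _ in kt tk.
have kN : (k < N)%N.
  by rewrite -(ltr_nat R) (le_lt_trans kt)// -[ltRHS]mulr1 ltr_pM2l.
exists k; split => //.
  rewrite /step_fun (bigD1 (Ordinal kN))//= big1 => [|i ik].
    rewrite addr0 indicE mem_set ?mulr1//= in_itv/=.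
    by rewrite ler_pdivrMr// ltr_pdivlMr// mulrC kt.
  rewrite indicE memNset ?mulr0//= in_itv/= ler_pdivrMr// ltr_pdivlMr// mulrC.
  move=> /andP[it ti]; move/negP: ik; apply; apply/eqP/val_inj => /=.
  have := le_lt_trans kt ti; have := le_lt_trans it tk; rewrite !ltr_nat !ltnS.
  by move=> ? ?; apply/eqP; rewrite eqn_leq; apply/andP.
rewrite ger0_norm; last by rewrite subr_ge0 ler_pdivrMr// mulrC.
rewrite lerBlDl -[X in _ + X]mul1r -mulrDl natr1 ler_pdivlMr// mulrC ltW//.
Qed.

Lemma integral_step_fun N a : (0 < N)%N ->
  (\int[lebesgue01 R]_t (step_fun N a t)%:E = (\sum_(k < N) a k * N%:R^-1)%:E)%E.
Proof.
move=> N0; have N0' : 0 < N%:R :> R by rewrite ltr0n.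
have lt1 : (lebesgue01 R setT < +oo)%E by rewrite lebesgue01T ltry.
under eq_integral do rewrite -sumEFin.
rewrite integral_sum//; last first.
  move=> k; rewrite -[X in integrable _ _ X]/(EFin \o _).
  apply: measurable_bounded_integrable => //.
    by apply: measurable_funM; [exact: measurable_cst|exact: measurable_indic].
  exists `|a k|; split; first exact: num_real.
  move=> M aM t _; rewrite /= (le_trans _ (ltW aM))// normrM indicE.
  by case: (_ \in _); rewrite ?normr1 ?normr0 ?mulr1 ?mulr0.
rewrite -sumEFin; apply: eq_bigr => k _.
under eq_integral do rewrite EFinM.
rewrite integralZl//; last first.
  apply: (@measurable_bounded_integrable _ _ _ _ (\1__)) => //.
  exists 1; split => // M M1 t _; rewrite /= (le_trans _ (ltW M1))// indicE.
  by case: (_ \in _); rewrite ?normr1 ?normr0.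
rewrite integral_indic// setIT EFinM; congr (_ * _)%E.
rewrite /lebesgue01/= /mrestr setIidl; last first.
  move=> t /=; rewrite !in_itv/= => /andP[kt tk]; apply/andP; split.
    by rewrite (le_trans _ kt)// divr_ge0// ler0n.
  rewrite (le_trans (ltW tk))// ler_pdivrMr// mul1r ler_nat; exact: ltn_ord.
rewrite lebesgue_measure_itv/= lte_fin ltr_pM2r ?invr_gt0// ltr_nat ltnSn.
by rewrite -EFinB -mulrBl -natrB// subSnn mul1r.
Qed.

(** The last hypothesis follows the sampling points near one fixed [t] and asks for nothing uniform
    in [t]; the constant [M] serves as dominating function on a space of measure 1. *)
Lemma riemann_sum_cvg (N : nat -> nat) (a : nat -> nat -> R) (g : R -> R) (M : R) :
  (forall n, (0 < N n)%N) -> measurable_fun [set: R] g ->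
  (forall n k, `|a n k| <= M) ->
  (forall (t : R) (k : nat -> nat), 0 <= t < 1 ->
     (forall n, `|t - (k n)%:R / (N n)%:R| <= (N n)%:R^-1) ->
     a n (k n) @[n --> \oo] --> g t) ->
  \sum_(k < N n) a n k * (N n)%:R^-1 @[n --> \oo] --> \int[lebesgue01 R]_t g t.
Proof.
move=> N0 mg aM ag.
have lt1 : (lebesgue01 R setT < +oo)%E by rewrite lebesgue01T ltry.
have M0 : 0 <= M by rewrite (le_trans _ (aM 0 0)%N).
have [] := @dominated_convergence _ _ _ (lebesgue01 R) setT measurableT
  (fun n t => (step_fun (N n) (a n) t)%:E) (EFin \o g) (cst M%:E).
- by move=> n; apply/measurable_EFinP; exact: measurable_step_fun.
- exact/measurable_EFinP.
- apply: lebesgue01_ae => t t01 _.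
  pose k n := sval (cid (step_funE (a n) (N0 n) t01)).
  have kP n := svalP (cid (step_funE (a n) (N0 n) t01)).
  apply: cvg_EFin; first by apply: nearW.
  rewrite (_ : _ \o _ = fun n => a n (k n)); last first.
    by apply/funext => n /=; case: (kP n).
  by apply: ag => // n; case: (kP n).
- rewrite -[cst _]/(EFin \o cst M); apply: measurable_bounded_integrable => //.
  exists M; split; first exact: num_real.
  by move=> x Mx t _ /=; rewrite ger0_norm// ltW.
- apply: lebesgue01_ae => t t01 n _.
  have [k [_ -> _]] := step_funE (a n) (N0 n) t01.
  by rewrite /= lee_fin.
move=> ig _ cg.
have {}cg : ((\sum_(k < N n) a n k * (N n)%:R^-1)%:E @[n --> \oo] -->
   \int[lebesgue01 R]_t (g t)%:E)%E.
  by under eq_fun do rewrite -integral_step_fun//.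
have fi := integrable_fin_num measurableT ig.
by rewrite -(fineK fi) in cg; exact: (fine_cvg cg).
Qed.

End RiemannSums.

(** * Convergence of the sampling maps and of their integrals *)

Section ShiftConvergence.
Variable R : realType.
Let N (n : nat) := n.+1.*2.+1.

Lemma sqrt_exp2 j : Num.sqrt ((2 ^+ j)^-1) = (Num.sqrt 2 ^+ j)^-1 :> R.
Proof.
rewrite sqrtrV ?exprn_ge0//; congr (_^-1).
by elim: j => [|j IH]; rewrite ?expr0 ?sqrtr1// !exprS sqrtrM// IH.
Qed.

Lemma invN_cvg0 : (N n)%:R^-1 @[n --> \oo] --> (0 : R).
Proof.
apply: (@squeeze_cvgr _ _ _ _ (cst 0) (fun n => n.+1%:R^-1)).
- apply: nearW => n; rewrite invr_ge0 ler0n /= lef_pV2 ?posrE ?ltr0n// ler_nat.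
  by rewrite /N; lia.
- exact: cvg_cst.
- exact: cvg_harmonic.
Qed.

Lemma exp2N_cvg0 : 2 ^- N n @[n --> \oo] --> (0 : R).
Proof.
apply: (@squeeze_cvgr _ _ _ _ (cst 0) (fun n => (N n)%:R^-1)).
- apply: nearW => n; rewrite invr_ge0 exprn_ge0//=.
  rewrite lef_pV2 ?posrE ?ltr0n ?exprn_gt0// -natrX ler_nat ltnW//.
  exact: ltn_expl.
- exact: cvg_cst.
- exact: invN_cvg0.
Qed.

Lemma cn_cvg j : cn R n.+1 j @[n --> \oo] --> (2 ^+ j.+1 : R)^-1.
Proof.
suff : cn R n.+1 j @[n --> \oo] --> (2 ^+ j.+1 * (1 - 0) : R)^-1 by rewrite subr0 mulr1.
apply: cvgV; first by rewrite subr0 mulr1 gt_eqF// exprn_gt0.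
apply: cvgM; first exact: cvg_cst.
apply: cvgB; first exact: cvg_cst.
exact: exp2N_cvg0.
Qed.

Lemma ss_X_cvg (t : R) (k : nat -> nat) :
  (forall n, `|t - (k n)%:R / (N n)%:R| <= (N n)%:R^-1) ->
  ss_X (shift_seq R n) (fvec R n.+1 (k n)) @[n --> \oo] --> (Xmap t : Qcube R).
Proof.
move=> kt; apply: cvg_Qcube => j.
rewrite Qproj_Xmap -sqrt_exp2.
have : (Num.sqrt (cn R n.+1 j))%:C *
    expi (2 * pi * (lseq j)%:~R * ((k n)%:R / (N n)%:R)) @[n --> \oo] -->
    (Num.sqrt ((2 ^+ j.+1)^-1))%:C * expi (2 * pi * (lseq j)%:~R * t).
  apply: cvg_realM_expi.
    apply: (@cvg_comp _ _ _ _ (@Num.sqrt R) \oo _ _ (@cn_cvg j)).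
    exact: sqrt_continuous.
  apply: cvgM; first exact: cvg_cst.
  apply/cvgrPdist_le => e e0.
  have /cvgrPdist_le/(_ _ e0) := invN_cvg0; apply: filterS => n.
  rewrite sub0r normrN; apply: le_trans; apply: (le_trans (kt n)).
  exact: ler_norm.
(* Coordinate [j] has the default value 0 while [j] is at least $N_n=2n+3$; from $n=j$ on the
   explicit formula applies. *)
apply: cvg_trans; apply: near_eq_cvg; exists j => // n /= jn.
by rewrite Qproj_ss_X// /N; lia.
Qed.

Lemma Re_sum n (F : 'I_n -> R[i]) :
  complex.Re (\sum_i F i) = \sum_i complex.Re (F i).
Proof. by rewrite (big_morph (@complex.Re R) (id1 := 0) (op1 := +%R))// => -[a b] [c d]. Qed.

Lemma Im_sum n (F : 'I_n -> R[i]) :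
  complex.Im (\sum_i F i) = \sum_i complex.Im (F i).
Proof. by rewrite (big_morph (@complex.Im R) (id1 := 0) (op1 := +%R))// => -[a b] [c d]. Qed.

Lemma shift_sum_cvg (g : Qcube R -> R) : continuous g ->
  \sum_(k < N n) g (ss_X (shift_seq R n) (fvec R n.+1 k)) * (N n)%:R^-1
    @[n --> \oo] --> \int[lebesgue01 R]_t g (Xmap t).
Proof.
move=> cg; have [M [_ gM]] := bounded_Qcube cg.
apply: (@riemann_sum_cvg _ N (fun n k => g (ss_X (shift_seq R n) (fvec R n.+1 k)))
  (fun t => g (Xmap t)) M) => //.
- apply: continuous_measurable_fun => t.
  by apply: (@continuous_comp _ _ _ (@Xmap R : R -> Qcube R) g);
    [exact: Xmap_continuous|exact: cg].
- move=> t k t01 kt.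
  by apply: (@cvg_comp _ _ _ _ g \oo _ _ (ss_X_cvg kt)); exact: cg.
Qed.

Lemma ss_integral_cvg (h : Qcube R -> R[i]) : continuous h ->
  ss_integral (@shift_seq R) h n @[n --> \oo] -->
  cintegral (lebesgue01 R) (h \o @Xmap R).
Proof.
move=> ch; rewrite /ss_integral.
under eq_fun do rewrite Omega_integral_shift//.
apply: cvg_complex.
  under eq_fun => n.
    rewrite Re_sum; under eq_bigr do rewrite mulrC Re_realM mulrC /=.
    over.
  apply: (@shift_sum_cvg (@complex.Re R \o h)) => q.
  by apply: continuous_comp; [exact: ch|exact: Re_continuous].
under eq_fun => n.
  rewrite Im_sum; under eq_bigr do rewrite mulrC Im_realM mulrC /=.
  over.
apply: (@shift_sum_cvg (@complex.Im R \o h)) => q.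
by apply: continuous_comp; [exact: ch|exact: Im_continuous].
Qed.

End ShiftConvergence.

(** * The limit measure *)

Section MeasuresOnCube.
Variable R : realType.
Local Notation Q := (Qcube R).

(** A continuous pseudometric that sees only the first [k] coordinates. It increases with [k], and
    the whole family determines the product topology. *)
Definition Qdist (k : nat) (q p : Q) : R :=
  \sum_(j < k) cmod (Qproj j q - Qproj j p).

Lemma Qdist_ge0 k q p : 0 <= Qdist k q p.
Proof. by apply: sumr_ge0 => j _; exact: cmod_ge0. Qed.

Lemma Qdist_triangle k q r p : Qdist k q p <= Qdist k q r + Qdist k r p.
Proof.
rewrite /Qdist -big_split/=; apply: ler_sum => j _.
rewrite -[X in cmod X](subrKA (Qproj j r)); exact: le_normcD.
Qed.

Lemma Qdist_sym k q p : Qdist k q p = Qdist k p q.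
Proof.
apply: eq_bigr => j _; rewrite -opprB.
by case: (_ - _) => a b; rewrite /= !sqrrN.
Qed.

Lemma Qdist_cvg0 (T : Type) (F : set_system T) (FF : Filter F)
    (p : T -> Q) k (q : Q) :
  (forall j, Qproj j (p x) @[x --> F] --> Qproj j q) ->
  Qdist k q (p x) @[x --> F] --> (0 : R).
Proof.
move=> pq; rewrite /Qdist; elim: k => [|k IH].
  under eq_fun do rewrite big_ord0.
  exact: cvg_cst.
under eq_fun do rewrite big_ord_recr/=.
have c : cmod (Qproj k q - Qproj k (p x)) @[x --> F] --> cmod (Qproj k q - Qproj k q).
  by apply: cvg_cmod; apply: cvgB; first exact: cvg_cst.
rewrite subrr [cmod 0]Normc.normc0 in c.
by rewrite -[X in nbhs X](addr0 (0 : R)); apply: cvgD.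
Qed.

(** Otherwise points [p n] outside [U] exist with [Qdist n q (p n)] below $1/(n+1)$. Each coordinate
    is dominated by this quantity once [n] exceeds its index, so [p n] tends to [q], which is
    absurd. One [n] governs both the radius and the number of coordinates. *)
Lemma Qdist_nbhs (q : Q) (U : set Q) : nbhs q U ->
  exists n, forall p, Qdist n q p < n.+1%:R^-1 -> U p.
Proof.
move=> Uq; apply: contrapT => /forallNP H.
have /choice[p pP] n : exists p, Qdist n q p < n.+1%:R^-1 /\ ~ U p.
  by have /existsNP[p /not_implyP] := H n; exists p.
have : p n @[n --> \oo] --> q.
  apply: cvg_Qcube => j.
  suff H0 : cmod (Qproj j q - Qproj j (p n)) @[n --> \oo] --> (0 : R).
    apply/cvgrPdist_lt => e e0.
    have eE : e = (complex.Re e)%:C.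
      by apply/eqP; rewrite eq_complex/= eqxx; case: e e0 => a b; rewrite ltcE/= => /andP[].
    have re0 : 0 < complex.Re e by rewrite eE ltcR in e0.
    move/cvgrPdist_lt : H0 => /(_ _ re0); apply: filterS => n.
    by rewrite sub0r normrN ger0_norm ?cmod_ge0// Defs.normcE eE ltcR.
  apply: (@squeeze_cvgr _ _ _ _ (cst 0) (fun n => n.+1%:R^-1)).
  - exists j.+1 => // n /= jn; rewrite cmod_ge0/=.
    rewrite (le_trans _ (ltW (pP n).1))// /Qdist (bigD1 (Ordinal jn))//= lerDl.
    by apply: sumr_ge0 => i _; exact: cmod_ge0.
  - exact: cvg_cst.
  - exact: cvg_harmonic.
move=> /(_ U Uq) [n _ /(_ n (leqnn n))]; exact: (pP n).2.
Qed.

(** Take $h_k=\min(1,k\,d_k)$ with $d_k$ the [Qdist k] distance to the complement, which is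
    1-Lipschitz. At a point of [U] the distances $d_k$ stay above some $1/(n+1)$ for $k\ge n$, so
    $h_k=1$ eventually; outside [U] they vanish. *)
Lemma open_approx (U : set Q) : open U -> exists h : nat -> Q -> R,
  [/\ forall k, continuous (h k), forall k q, 0 <= h k q <= 1 &
      forall q, h k q @[k --> \oo] --> (\1_U q : R)].
Proof.
(* The whole cube is treated apart: its complement is empty, and [inf] of the empty set defaults to
   0, which would produce the zero function. *)
move=> oU; have [UT|/existsNP[p0 p0U]] := pselect (forall q, U q).
  exists (fun _ _ => 1); split; first by move=> k q; exact: (@cvg_cst _ _ _ _ (nbhs_filter q)).
    by move=> k q; rewrite ler01 lexx.
  by move=> q; rewrite indicE mem_set//; exact: cvg_cst.
pose E k q := [set Qdist k q p | p in ~` U]; pose d k q := inf (E k q).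
have E0 k q : E k q !=set0 by exists (Qdist k q p0), p0.
have Elb k q : has_lbound (E k q) by exists 0 => _ [p _ <-]; exact: Qdist_ge0.
have d0 k q : 0 <= d k q by apply: lb_le_inf => // _ [p _ <-]; exact: Qdist_ge0.
have dlip k q r : d k q <= d k r + Qdist k q r.
  rewrite -lerBlDr; apply: lb_le_inf => // _ [p pU <-].
  rewrite lerBlDr addrC (le_trans _ (Qdist_triangle _ _ _ _))//.
  by apply: ge_inf => //; exists p.
exists (fun k q => Num.min 1 (k%:R * d k q)); split.
- move=> k q; have Fq : Filter (nbhs q) := nbhs_filter q.
  apply: (@continuous_min R Q (cst 1) (fun q => k%:R * d k q)).
    exact: cvg_cst.
  apply: cvgM; first exact: cvg_cst.
  apply/cvgrPdist_le => e e0.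
  have /cvgrPdist_le/(_ _ e0) := @Qdist_cvg0 Q (nbhs q) Fq idfun k q (fun j => @Qproj_continuous R j q); apply: filterS => p.
  rewrite sub0r normrN ger0_norm ?Qdist_ge0// => h.
  by rewrite ler_distl; have := dlip k q p; have := dlip k p q;
    rewrite (Qdist_sym k p); lra.
- by move=> k q; rewrite le_min ler01 mulr_ge0//= ge_min lexx.
- move=> q; rewrite indicE; have [Uq|nUq] := pselect (U q).
    rewrite mem_set//; apply: cvg_near_cst.
    have [n nU] := Qdist_nbhs (open_nbhs_nbhs (conj oU Uq)).
    exists n.+1 => // k /= nk; apply/min_idPl.
    rewrite -ler_pdivrMl ?ltr0n ?(leq_trans _ nk)// mulr1.
    apply: lb_le_inf => // _ [p pU <-].
    have /negP : ~ Qdist n q p < n.+1%:R^-1 by move/nU.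
    rewrite -leNgt => h.
    rewrite (@le_trans _ _ n.+1%:R^-1)//.
      by rewrite lef_pV2 ?posrE ?ltr0n ?(leq_trans _ nk)// ler_nat.
    rewrite (le_trans h)// /Qdist -(subnKC (ltnW nk)) big_split_ord/= lerDl.
    by apply: sumr_ge0 => i _; exact: cmod_ge0.
  rewrite memNset//; apply: cvg_near_cst; apply: nearW => k.
  suff -> : d k q = 0 by rewrite mulr0; apply/min_idPr.
  apply/eqP; rewrite eq_le d0 andbT; apply: ge_inf => //.
  exists q => //; apply: big1 => j _; rewrite subrr; exact: Normc.normc0.
Qed.

Lemma integrable_bounded_borelQ (m : probability (borelQ R) R) (g : Q -> R) :
  continuous g -> m.-integrable setT (EFin \o g).
Proof.
move=> cg; have [M [_ gM]] := bounded_Qcube cg.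
apply: measurable_bounded_integrable => //.
- by rewrite (le_lt_trans (probability_le1 _ _))// ltry.
- exact: measurable_continuous_borelQ.
- exists M; split; first exact: num_real.
  by move=> x Mx t _; rewrite /= (le_trans (gM t))// ltW.
Qed.

Lemma eq_measure_borelQ (m1 m2 : probability (borelQ R) R) :
  (forall g : Q -> R, continuous g -> \int[m1]_q g q = \int[m2]_q g q) ->
  forall B : set (borelQ R), measurable B -> m1 B = m2 B.
Proof.
move=> m12.
have cvg_open (m : probability (borelQ R) R) (U : set Q) (h : nat -> Q -> R) :
    open U -> (forall k, continuous (h k)) -> (forall k q, 0 <= h k q <= 1) ->
    (forall q, h k q @[k --> \oo] --> (\1_U q : R)) ->
    \int[m]_q h k q @[k --> \oo] --> fine (m U).
  move=> oU ch h01 hU; have mU : measurable (U : set (borelQ R)).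
    exact: sub_sigma_algebra.
  have [] := @dominated_convergence _ _ _ m setT measurableT
    (fun k => EFin \o h k) (EFin \o \1_U) (cst 1%E).
  - by move=> k; apply/measurable_EFinP; exact: measurable_continuous_borelQ.
  - by apply/measurable_EFinP; exact: measurable_indic.
  - by apply: aeW => q _; apply: cvg_EFin; [exact: nearW|exact: hU].
  - by apply: (@integrable_bounded_borelQ m (cst 1)) => q; exact: (@cvg_cst _ _ _ _ (nbhs_filter q)).
  - by apply: aeW => q k _; rewrite /= lee_fin ger0_norm; case/andP: (h01 k q).
  move=> _ _; rewrite [X in _ --> X](_ : _ = m U); last first.
    by rewrite /= integral_indic// setIT.
  rewrite -(@fineK _ (m U)) ?fin_num_measure//; exact: fine_cvg.
(* Open sets are stable under intersection and generate the sigma-algebra by definition. The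
   exhausting sequence is constantly the whole cube, since both measures are finite. *)
refine (@measure_unique _ R (borelQ R) (@open (Qcube R)) (fun=> setT) erefl
  _ _ _ m1 m2 _ _).
- by move=> A B; exact: openI.
- by move=> _; exact: openT.
- by apply/seteqP; split => // x _; exists 0%N.
- move=> U oU; have [h [ch h01 hU]] := open_approx oU.
  have c1 := cvg_open m1 U h oU ch h01 hU.
  have c2 := cvg_open m2 U h oU ch h01 hU.
  have e : (fun k => \int[m1]_q h k q) = (fun k => \int[m2]_q h k q).
    by apply/funext => k; exact: m12.
  rewrite e in c1.
  have e2 : fine (m1 U) = fine (m2 U) by exact: cvg_unique (@Rhausdorff R) _ _ _ _ c1 c2.
  have mU : measurable (U : set (borelQ R)) by exact: sub_sigma_algebra.
  by rewrite -[LHS]fineK ?fin_num_measure// e2 fineK// fin_num_measure.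
- by move=> _; rewrite (le_lt_trans (probability_le1 _ _))// ltry.
Qed.

End MeasuresOnCube.

(** * The law of [X] is the only limit measure *)

Section LimitMeasure.
Variable R : realType.

(** The pushforward gets a name to which the structure of a probability can be attached; it is the
    witness for the existence of a limit measure. *)
Definition Xlaw : set (borelQ R) -> \bar R := pushforward (lebesgue01 R) (@Xmap R).

Let Xlaw0 : Xlaw set0 = 0%E.
Proof. by rewrite /Xlaw /pushforward preimage_set0 measure0. Qed.

Let Xlaw_ge0 A : (0 <= Xlaw A)%E.
Proof. by rewrite /Xlaw /pushforward measure_ge0. Qed.

Let Xlaw_sigma_additive : semi_sigma_additive Xlaw.
Proof.
move=> F mF tF mUF; rewrite /Xlaw /pushforward preimage_bigcup.
apply: measure_semi_sigma_additive.
- by move=> n; rewrite -[X in measurable X]setTI; exact: measurable_Xmap.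
- apply/trivIsetP => /= i j _ _ ij; rewrite -preimage_setI.
  by move/trivIsetP : tF => /(_ _ _ _ _ ij) ->//; rewrite preimage_set0.
- by rewrite -preimage_bigcup -[X in measurable X]setTI; exact: measurable_Xmap.
Qed.

HB.instance Definition _ := isMeasure.Build _ _ _ Xlaw
  Xlaw0 Xlaw_ge0 Xlaw_sigma_additive.

Let Xlaw_setT : Xlaw setT = 1%E.
Proof. by rewrite /Xlaw /pushforward preimage_setT lebesgue01T. Qed.

HB.instance Definition _ := Measure_isProbability.Build _ _ _ Xlaw Xlaw_setT.

Lemma integrable_comp_Xmap (g : Qcube R -> R) : continuous g ->
  (lebesgue01 R).-integrable setT (EFin \o (g \o @Xmap R)).
Proof.
move=> cg; have [M [_ gM]] := bounded_Qcube cg.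
apply: measurable_bounded_integrable => //.
- by rewrite lebesgue01T ltry.
- apply: (@measurableT_comp _ _ _ _ _ _ (g : borelQ R -> R)).
    exact: measurable_continuous_borelQ.
  exact: measurable_Xmap.
- exists M; split; first exact: num_real.
  by move=> x Mx t _; rewrite /= (le_trans (gM _))// ltW.
Qed.

Lemma Rintegral_Xlaw (g : Qcube R -> R) : continuous g ->
  \int[Xlaw]_q g q = \int[lebesgue01 R]_t g (Xmap t).
Proof.
move=> cg; rewrite /Rintegral; congr fine.
rewrite -[RHS]/(\int[lebesgue01 R]_(t in (@Xmap R) @^-1` setT)
  ((EFin \o (g : borelQ R -> R)) \o (@Xmap R)) t)%E.
rewrite -(integral_pushforward (@measurable_Xmap R))//.
- by apply/measurable_EFinP; exact: measurable_continuous_borelQ.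
- exact: integrable_comp_Xmap.
Qed.

Lemma is_limit_measure_Xlaw : is_limit_measure (@shift_seq R) Xlaw.
Proof.
move=> h ch; rewrite (cvg_lim (@complex_hausdorff R) (ss_integral_cvg ch)).
rewrite /cintegral; congr (_ +i* _).
  apply: (@Rintegral_Xlaw (@complex.Re R \o h)) => q.
  by apply: continuous_comp; [exact: ch|exact: Re_continuous].
apply: (@Rintegral_Xlaw (@complex.Im R \o h)) => q.
by apply: continuous_comp; [exact: ch|exact: Im_continuous].
Qed.

Lemma limit_measure_unique (mu : probability (borelQ R) R) :
  is_limit_measure (@shift_seq R) mu ->
  forall B : set (borelQ R), measurable B ->
    mu B = pushforward (lebesgue01 R) (@Xmap R) B.
Proof.
move=> muP; apply: (@eq_measure_borelQ R mu Xlaw) => g cg.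
have cgC : continuous (fun q => (g q)%:C : R[i]).
  move=> q; apply: (@cvg_complex _ _ _ (nbhs_filter q)); first exact: cg.
  exact: (@cvg_cst _ _ _ _ (nbhs_filter q)).
have := muP _ cgC; rewrite -(is_limit_measure_Xlaw cgC).
by move/(congr1 (@complex.Re R)).
Qed.

End LimitMeasure.

(** * Complex L2 functions *)

Section ComplexL2.
Variables (R : realType) (d : measure_display) (T : measurableType d).
Variable mu : {measure set T -> \bar R}.
Implicit Types f g : T -> R[i].

Definition cmeasurable f :=
  measurable_fun [set: T] (fun t => complex.Re (f t)) /\
  measurable_fun [set: T] (fun t => complex.Im (f t)).

Lemma ReD (z y : R[i]) : complex.Re (z + y) = complex.Re z + complex.Re y.
Proof. by case: z y => [a b] [c e]. Qed.

Lemma ImD (z y : R[i]) : complex.Im (z + y) = complex.Im z + complex.Im y.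
Proof. by case: z y => [a b] [c e]. Qed.

Lemma ReM (z y : R[i]) :
  complex.Re (z * y) = complex.Re z * complex.Re y - complex.Im z * complex.Im y.
Proof. by case: z y => [a b] [c e]. Qed.

Lemma ImM (z y : R[i]) :
  complex.Im (z * y) = complex.Re z * complex.Im y + complex.Im z * complex.Re y.
Proof. by case: z y => [a b] [c e]. Qed.

Lemma cmeasurable_cst (z : R[i]) : cmeasurable (fun=> z).
Proof. by split; exact: measurable_cst. Qed.

Lemma cmeasurableD f g : cmeasurable f -> cmeasurable g ->
  cmeasurable (fun t => f t + g t).
Proof.
move=> [fr fi] [gr gi]; split.
  by under eq_fun do rewrite ReD; exact: measurable_funD.
by under eq_fun do rewrite ImD; exact: measurable_funD.
Qed.

Lemma cmeasurableB f g : cmeasurable f -> cmeasurable g ->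
  cmeasurable (fun t => f t - g t).
Proof.
move=> [fr fi] [gr gi]; split.
  by under eq_fun do rewrite ReB; exact: measurable_funB.
by under eq_fun do rewrite ImB; exact: measurable_funB.
Qed.

Lemma cmeasurableM f g : cmeasurable f -> cmeasurable g ->
  cmeasurable (fun t => f t * g t).
Proof.
move=> [fr fi] [gr gi]; split.
  by under eq_fun do rewrite ReM; apply: measurable_funB; exact: measurable_funM.
by under eq_fun do rewrite ImM; apply: measurable_funD; exact: measurable_funM.
Qed.

Lemma cmeasurable_conj f : cmeasurable f -> cmeasurable (fun t => (f t)^*).
Proof.
move=> [fr fi]; split.
  by rewrite (_ : (fun _ => _) = (fun t => complex.Re (f t)))//;
    apply/funext => t; case: (f t).
rewrite (_ : (fun _ => _) = (fun t => - complex.Im (f t))); last first.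
  by apply/funext => t; case: (f t).
exact: measurable_funN.
Qed.

Lemma cmeasurable_sum (I : Type) (s : seq I) (F : I -> T -> R[i]) :
  (forall i, cmeasurable (F i)) -> cmeasurable (fun t => \sum_(i <- s) F i t).
Proof.
move=> mF; elim: s => [|i s IH].
  by under eq_fun do rewrite big_nil; exact: cmeasurable_cst.
by under eq_fun do rewrite big_cons; exact: cmeasurableD.
Qed.

Lemma measurable_cmod_sqr f : cmeasurable f ->
  measurable_fun [set: T] (fun t => (cmod (f t) ^+ 2)%:E).
Proof.
move=> [fr fi]; apply/measurable_EFinP; under eq_fun do rewrite cmod_sqr.
by apply: measurable_funD; exact: measurable_funX.
Qed.

Lemma measurable_cmod f : cmeasurable f ->
  measurable_fun [set: T] (fun t => cmod (f t)).
Proof.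
move=> /measurable_cmod_sqr /measurable_EFinP mf.
rewrite (_ : (fun t => cmod (f t)) = (fun t => Num.sqrt (cmod (f t) ^+ 2))).
  exact: (measurableT_comp (continuous_measurable_fun (@sqrt_continuous R))).
by apply/funext => t; rewrite sqrtr_sqr ger0_norm ?cmod_ge0.
Qed.

Lemma L2sq_ge0 f : (0 <= L2sq mu f)%E.
Proof. by apply: integral_ge0 => t _; rewrite lee_fin sqr_ge0. Qed.

Lemma L2sq_ae_eq f g : cmeasurable f -> cmeasurable g ->
  {ae mu, forall t, f t = g t} -> L2sq mu f = L2sq mu g.
Proof.
move=> mf mg fg; apply: ae_eq_integral => //; try exact: measurable_cmod_sqr.
by apply: filterS fg => t -> _.
Qed.

Lemma L2sq_eq0 f : cmeasurable f -> L2sq mu f = 0%E -> {ae mu, forall t, f t = 0}.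
Proof.
move=> mf f0; have := ae_eq_integral_abs mu measurableT (measurable_cmod_sqr mf).
under eq_integral do rewrite gee0_abs ?lee_fin ?sqr_ge0//.
move=> -[/(_ f0) + _]; apply: filterS => t /(_ I)[].
move/eqP; rewrite sqrf_eq0 => /eqP; case: (f t) => a b; exact: Normc.eq0_normc.
Qed.

(** The bridge from pointwise quadratic bounds to norms. It holds in the extended reals, so no
    function has to be known to lie in L2 beforehand. *)
Lemma L2sq_le_comb f g h (a b : R) : 0 <= a -> 0 <= b ->
  cmeasurable f -> cmeasurable g -> cmeasurable h ->
  (forall t, cmod (f t) ^+ 2 <= a * cmod (g t) ^+ 2 + b * cmod (h t) ^+ 2) ->
  (L2sq mu f <= a%:E * L2sq mu g + b%:E * L2sq mu h)%E.
Proof.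
move=> a0 b0 mf mg mh fgh.
have mg2 := measurable_cmod_sqr mg; have mh2 := measurable_cmod_sqr mh.
have sq0 (k : T -> R[i]) t : (0 <= (cmod (k t) ^+ 2)%:E)%E.
  by rewrite lee_fin sqr_ge0.
have mag : measurable_fun [set: T] (fun t => a%:E * (cmod (g t) ^+ 2)%:E)%E.
  exact: measurable_funeM.
have mbh : measurable_fun [set: T] (fun t => b%:E * (cmod (h t) ^+ 2)%:E)%E.
  exact: measurable_funeM.
rewrite /L2sq -(ge0_integralZl mu measurableT mg2)//.
rewrite -(ge0_integralZl mu measurableT mh2)//.
rewrite -(ge0_integralD mu measurableT _ mag _ mbh)//; last 2 first.
- by move=> t _; rewrite mule_ge0// lee_fin.
- by move=> t _; rewrite mule_ge0// lee_fin.
apply: ge0_le_integral => //.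
- exact: measurable_cmod_sqr.
- exact: emeasurable_funD.
- by move=> t _; rewrite -!EFinM -EFinD lee_fin.
Qed.

(** The difference of the two sides is $e^{-1}|ez-y|^2$. The choice $e=1$ gives the factor 2 of
    rough estimates; small [e] gives the sharp ones behind equality of norms. *)
Lemma cmod_sqrD (z y : R[i]) (e : R) : 0 < e ->
  cmod (z + y) ^+ 2 <= (1 + e) * cmod z ^+ 2 + (1 + e^-1) * cmod y ^+ 2.
Proof.
move=> e0; rewrite !cmod_sqr ReD ImD.
case: z y => [a b] [c g] /=; rewrite -subr_ge0.
have -> : (1 + e) * (a ^+ 2 + b ^+ 2) + (1 + e^-1) * (c ^+ 2 + g ^+ 2) -
  ((a + c) ^+ 2 + (b + g) ^+ 2) =
  e^-1 * ((e * a - c) ^+ 2 + (e * b - g) ^+ 2).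
  by field; rewrite gt_eqF.
by apply: mulr_ge0; [rewrite invr_ge0 ltW|rewrite addr_ge0 ?sqr_ge0].
Qed.

Lemma L2sqD_le f g : cmeasurable f -> cmeasurable g ->
  (L2sq mu (fun t => f t + g t)%R <= 2%:E * L2sq mu f + 2%:E * L2sq mu g)%E.
Proof.
move=> mf mg; apply: L2sq_le_comb => //; first exact: cmeasurableD.
move=> t; have := cmod_sqrD (f t) (g t) (@ltr01 R).
by rewrite invr1 (_ : 1 + 1 = 2).
Qed.

Lemma L2sqZ (z : R[i]) f : cmeasurable f ->
  (L2sq mu (fun t => z * f t)%R = (cmod z ^+ 2)%:E * L2sq mu f)%E.
Proof.
move=> mf; rewrite /L2sq -ge0_integralZl//; last 3 first.
- exact: measurable_cmod_sqr.
- by move=> t _; rewrite lee_fin sqr_ge0.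
- by rewrite lee_fin sqr_ge0.
by apply: eq_integral => t _; rewrite cmodM exprMn EFinM.
Qed.

(** The common last step of the defect estimates; the bound at $n=0$ already makes the extended
    value finite. *)
Lemma ge0_le_cvg0 (x : \bar R) (u : nat -> R) :
  (0 <= x)%E -> (forall n, (x <= (u n)%:E)%E) -> u n @[n --> \oo] --> (0 : R) ->
  x = 0%E.
Proof.
move=> x0 xu u0; have xfin : x \is a fin_num.
  by rewrite ge0_fin_numE// (le_lt_trans (xu 0%N))// ltry.
apply/eqP; rewrite eq_le x0 andbT -(fineK xfin) lee_fin.
apply: (cvgr_to_ge u0).
by apply: nearW => n; rewrite -lee_fin fineK.
Qed.

End ComplexL2.

(** * Orthonormal systems *)

Section ComplexIntegral.
Variables (R : realType) (d : measure_display) (T : measurableType d).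
Variable mu : {measure set T -> \bar R}.
Implicit Types f g : T -> R[i].

Definition cintegrable f :=
  mu.-integrable setT (fun t => (complex.Re (f t))%:E) /\
  mu.-integrable setT (fun t => (complex.Im (f t))%:E).

Lemma bounded_cintegrable f (M : R) : (mu setT < +oo)%E -> cmeasurable f ->
  (forall t, cmod (f t) <= M) -> cintegrable f.
Proof.
move=> mufin [fr fi] fM; split.
  apply: (@measurable_bounded_integrable _ _ _ _ (fun t => complex.Re (f t))) => //.
  exists M; split; first exact: num_real.
  by move=> x Mx t _ /=; rewrite (le_trans (Re_le_cmod _))// (le_trans (fM t))// ltW.
apply: (@measurable_bounded_integrable _ _ _ _ (fun t => complex.Im (f t))) => //.
exists M; split; first exact: num_real.
by move=> x Mx t _ /=; rewrite (le_trans (Im_le_cmod _))// (le_trans (fM t))// ltW.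
Qed.

Lemma cintegrableD f g : cintegrable f -> cintegrable g ->
  cintegrable (fun t => f t + g t).
Proof.
move=> [fr fi] [gr gi]; split.
  by under eq_fun do rewrite ReD EFinD; exact: integrableD.
by under eq_fun do rewrite ImD EFinD; exact: integrableD.
Qed.

Lemma cintegralD f g : cintegrable f -> cintegrable g ->
  cintegral mu (fun t => f t + g t) = cintegral mu f + cintegral mu g.
Proof.
move=> [fr fi] [gr gi]; rewrite /cintegral.
under eq_Rintegral do rewrite ReD.
under [X in _ +i* X]eq_Rintegral do rewrite ImD.
by rewrite !RintegralD.
Qed.

Lemma cintegrableZ (z : R[i]) f : cintegrable f -> cintegrable (fun t => z * f t).
Proof.
move=> [fr fi]; split.
  under eq_fun do rewrite ReM EFinB !EFinM.
  by apply: integrableB => //; exact: integrableZl.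
under eq_fun do rewrite ImM EFinD !EFinM.
by apply: integrableD => //; exact: integrableZl.
Qed.

Lemma cintegralZ (z : R[i]) f : cintegrable f ->
  cintegral mu (fun t => z * f t) = z * cintegral mu f.
Proof.
move=> [fr fi]; rewrite /cintegral.
have Zl (c : R) (h : T -> R) : mu.-integrable setT (fun t => (h t)%:E) ->
    mu.-integrable setT (EFin \o (fun t => c * h t)).
  by move=> ih; exact: (integrableZl measurableT c ih).
under eq_Rintegral do rewrite ReM.
under [X in _ +i* X]eq_Rintegral do rewrite ImM.
rewrite RintegralB ?RintegralD// ?RintegralZl//; try exact: Zl.
by case: z => a b.
Qed.

Lemma cintegral0 : cintegral mu (fun=> 0) = 0.
Proof. by rewrite /cintegral !Rintegral_cst// !mul0r. Qed.

Lemma cintegrable0 : cintegrable (fun=> 0).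
Proof. by split; exact: integrable0. Qed.

Lemma cintegrable_sum (I : Type) (s : seq I) (F : I -> T -> R[i]) :
  (forall i, cintegrable (F i)) -> cintegrable (fun t => \sum_(i <- s) F i t).
Proof.
move=> iF; elim: s => [|i s IH].
  by under eq_fun do rewrite big_nil; exact: cintegrable0.
by under eq_fun do rewrite big_cons; exact: cintegrableD.
Qed.

Lemma cintegral_sum (I : Type) (s : seq I) (F : I -> T -> R[i]) :
  (forall i, cintegrable (F i)) ->
  cintegral mu (fun t => \sum_(i <- s) F i t) = \sum_(i <- s) cintegral mu (F i).
Proof.
move=> iF; elim: s => [|i s IH].
  rewrite big_nil -[RHS]cintegral0; congr cintegral.
  by apply/funext => t; rewrite big_nil.
rewrite big_cons -IH -cintegralD//; last exact: cintegrable_sum.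
by congr cintegral; apply/funext => t; rewrite big_cons.
Qed.

End ComplexIntegral.

Section OrthonormalSystem.
Variables (R : realType) (d : measure_display) (T : measurableType d).
Variable mu : {measure set T -> \bar R}.
Hypothesis mufin : (mu setT < +oo)%E.
Variables (w : nat -> T -> R[i]) (B : nat -> R).
Hypothesis mw : forall j, cmeasurable (w j).
Hypothesis bw : forall j t, cmod (w j t) <= B j.
Hypothesis ow : forall i j,
  cintegral mu (fun t => w i t * (w j t)^*) = (i == j)%:R.

Lemma mul_conj (z : R[i]) : z * z^* = (cmod z ^+ 2)%:C.
Proof.
rewrite cmod_sqr; case: z => a b; apply/eqP; rewrite eq_complex/=.
by apply/andP; split; apply/eqP; ring.
Qed.

Lemma cmod_conj (z : R[i]) : cmod z^* = cmod z.
Proof. by case: z => a b; rewrite /= sqrrN. Qed.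

(** Pythagoras: $|S|^2$ is expanded into the complex double sum [G] and integrated term by term.
    Boundedness of the [w j] makes every product integrable. *)
Lemma L2sq_orthonormal_sum (a : nat -> R[i]) (s : seq nat) : uniq s ->
  L2sq mu (fun t => \sum_(j <- s) a j * w j t) =
  (\sum_(j <- s) cmod (a j) ^+ 2)%:E.
Proof.
move=> us; pose S t := \sum_(j <- s) a j * w j t.
pose G t := \sum_(i <- s) \sum_(j <- s) (a i * (a j)^*) * (w i t * (w j t)^*).
have SG t : (cmod (S t) ^+ 2)%:C = G t.
  rewrite -mul_conj /S rmorph_sum/= mulr_suml; apply: eq_bigr => i _.
  rewrite mulr_sumr; apply: eq_bigr => j _; rewrite rmorphM/=.
  by rewrite mulrACA.
have iww i j : cintegrable mu (fun t => w i t * (w j t)^*).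
  apply: (@bounded_cintegrable _ _ _ _ _ (B i * B j)) => //.
    by apply: cmeasurableM => //; exact: cmeasurable_conj.
  by move=> t; rewrite cmodM cmod_conj ler_pM ?cmod_ge0.
have iG : cintegrable mu G.
  by apply: cintegrable_sum => i; apply: cintegrable_sum => j; exact: cintegrableZ.
have GE : cintegral mu G = (\sum_(j <- s) cmod (a j) ^+ 2)%:C.
  rewrite cintegral_sum; last first.
    by move=> i; apply: cintegrable_sum => j; exact: cintegrableZ.
  rewrite rmorph_sum/=; apply: eq_big_seq => i is_.
  rewrite cintegral_sum; last by move=> j; exact: cintegrableZ.
  rewrite (bigD1_seq i)//= big1 => [|j ji]; last first.
    by rewrite cintegralZ// ow eq_sym (negbTE ji) mulr0.
  by rewrite addr0 cintegralZ// ow eqxx mulr1 mul_conj.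
have : \int[mu]_t complex.Re (G t) = \sum_(j <- s) cmod (a j) ^+ 2.
  by move: GE => /(congr1 (@complex.Re R)).
(* The real integral is a [fine], which forgets infinite values; integrability of [G] recovers the
   identity in the extended reals. *)
rewrite /Rintegral => GE'; rewrite -GE' fineK; last first.
  exact: (integrable_fin_num measurableT iG.1).
by apply: eq_integral => t _; rewrite -SG.
Qed.

Definition partial_sum (a : nat -> R[i]) n t := \sum_(0 <= j < n) a j * w j t.

Lemma cmeasurable_partial_sum a n : cmeasurable (partial_sum a n).
Proof.
apply: cmeasurable_sum => j; apply: cmeasurableM => //; exact: cmeasurable_cst.
Qed.

Lemma L2sq_partial_sumB a n m : (n <= m)%N ->
  L2sq mu (fun t => partial_sum a m t - partial_sum a n t) =
  (\sum_(n <= j < m) cmod (a j) ^+ 2)%:E.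
Proof.
move=> nm; rewrite -L2sq_orthonormal_sum ?iota_uniq//; congr L2sq.
apply/funext => t; apply/eqP; rewrite subr_eq addrC /partial_sum.
by rewrite -big_cat_nat.
Qed.

Definition sqtail (a : nat -> R[i]) n : \bar R :=
  (\sum_(n <= j <oo) (cmod (a j) ^+ 2)%:E)%E.

Lemma sqtail_ge a n m :
  ((\sum_(n <= j < m) cmod (a j) ^+ 2)%:E <= sqtail a n)%E.
Proof.
rewrite -sumEFin; apply: nneseries_lim_ge => j _ _.
by rewrite lee_fin sqr_ge0.
Qed.

Lemma sqtail_split a n :
  (sqtail a 0 = (\sum_(0 <= j < n) cmod (a j) ^+ 2)%:E + sqtail a n)%E.
Proof.
rewrite /sqtail (nneseries_split 0 n) ?add0n ?sumEFin// => j _.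
by rewrite lee_fin sqr_ge0.
Qed.

Lemma sqtail_ge0 a n : (0 <= sqtail a n)%E.
Proof. by apply: nneseries_ge0 => j _ _; rewrite lee_fin sqr_ge0. Qed.

Lemma sqtail_fin a n : (sqtail a 0 < +oo)%E -> sqtail a n \is a fin_num.
Proof.
move=> a0; rewrite ge0_fin_numE ?sqtail_ge0// (le_lt_trans _ a0)//.
rewrite (sqtail_split a n) leeDr// lee_fin; apply: sumr_ge0 => j _; exact: sqr_ge0.
Qed.

Lemma sqtail_cvg0 a : (sqtail a 0 < +oo)%E ->
  fine (sqtail a n) @[n --> \oo] --> (0 : R).
Proof.
move=> a0; apply: fine_cvg; apply: nneseries_tail_cvg => //.
by move=> j _; rewrite lee_fin sqr_ge0.
Qed.

End OrthonormalSystem.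

(** * Completeness: summing an orthonormal series in L2 *)

Section RieszFischer.
Variables (R : realType) (d : measure_display) (T : measurableType d).
Variable mu : {measure set T -> \bar R}.
Hypothesis mufin : (mu setT < +oo)%E.
Variables (w : nat -> T -> R[i]) (B : nat -> R).
Hypothesis mw : forall j, cmeasurable (w j).
Hypothesis bw : forall j t, cmod (w j t) <= B j.
Hypothesis ow : forall i j,
  cintegral mu (fun t => w i t * (w j t)^*) = (i == j)%:R.

Lemma fast_subsequence (u : nat -> R) : u n @[n --> \oo] --> (0 : R) ->
  exists m : nat -> nat, [/\ forall k, (k <= m k)%N,
    forall k, (m k <= m k.+1)%N & forall k, u (m k) <= 4 ^- k].
Proof.
move=> /cvgrPdist_le u0.
have /choice[N NP] k : exists N, forall n, (N <= n)%N -> u n <= 4 ^- k.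
  have [|N _ NP] := u0 (4 ^- k); first by rewrite invr_gt0 exprn_gt0.
  exists N => n Nn; have := NP n Nn; rewrite sub0r normrN; apply: le_trans.
  exact: ler_norm.
(* Adding up the thresholds makes the index monotone and at least $N_k$; the summand [k] makes it at
   least [k]. *)
exists (fun k => k + \sum_(i < k.+1) N i)%N; split => k.
- exact: leq_addr.
- by apply: leq_add => //; rewrite [leqRHS]big_ord_recr/= leq_addr.
- by apply: NP; rewrite big_ord_recr/= addnA leq_addl.
Qed.

(* AM-GM with weight 2^-k turns the L2 bound 4^-k into an L1 bound of order 2^-k. *)
Lemma integral_cmod_le f k : cmeasurable f -> (L2sq mu f <= (4 ^- k)%:E)%E ->
  (\int[mu]_t (cmod (f t))%:E <= ((fine (mu setT) + 1) * 2 ^- k)%:E)%E.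
Proof.
move=> mf f4; have p0 : 0 < 2 ^+ k :> R by rewrite exprn_gt0.
have mufin' : mu setT \is a fin_num by rewrite ge0_fin_numE.
have mf2 := measurable_cmod_sqr mf.
apply: (@le_trans _ _ (\int[mu]_t ((2 ^- k)%:E + (2 ^+ k)%:E * (cmod (f t) ^+ 2)%:E))%E).
  apply: ge0_le_integral => //.
  - by move=> t _; rewrite lee_fin cmod_ge0.
  - by apply/measurable_EFinP; exact: measurable_cmod.
  - by apply: emeasurable_funD; [exact: measurable_cst|exact: measurable_funeM].
  - move=> t _; rewrite -EFinM -EFinD lee_fin.
    have := cmod_ge0 (f t); move: (cmod _) => x x0.
    rewrite -(ler_pM2l p0) mulrDr mulfV ?gt_eqF//.
    by move: (2 ^+ k) p0 => p p0; nra.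
rewrite ge0_integralD//; last 2 first.
- by move=> t _; rewrite -EFinM lee_fin mulr_ge0 ?sqr_ge0// ltW.
- exact: measurable_funeM.
rewrite integral_cst// ge0_integralZl//; last first.
  by move=> t _; rewrite lee_fin sqr_ge0.
rewrite mulrDl mul1r EFinD -{1}(fineK mufin') -EFinM [(2 ^- k * _)%R]mulrC.
rewrite leeD2l//; apply: (le_trans (lee_wpmul2l _ f4)); first by rewrite lee_fin ltW.
rewrite -EFinM lee_fin (_ : 4 = 2 * 2)%R ?exprMn ?invfM ?mulrA; last by ring.
by rewrite mulfV ?mul1r// gt_eqF.
Qed.

(** A rapidly Cauchy subsequence of partial sums converges almost everywhere, and Fatou's lemma
    hands the tail bound to its limit. The bound is stated against every partial sum because norm,
    linearity and values on basis vectors are later read off from it. *)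
Lemma riesz_fischer (a : nat -> R[i]) : (sqtail a 0 < +oo)%E ->
  exists f, cmeasurable f /\
    forall n, (L2sq mu (fun t => f t - partial_sum w a n t)%R <= sqtail a n)%E.
Proof.
move=> a0.
have [m [mk mS m4]] := fast_subsequence (sqtail_cvg0 a0).
pose S k t := partial_sum w a (m k) t.
have mSk k : cmeasurable (S k) by exact: cmeasurable_partial_sum.
pose D k t := S k.+1 t - S k t.
have mD k : cmeasurable (D k) by exact: cmeasurableB.
have D4 k : (L2sq mu (D k) <= (4 ^- k)%:E)%E.
  rewrite (L2sq_partial_sumB mufin mw bw ow _ (mS k)).
  apply: (le_trans (sqtail_ge _ _ _)).
  by rewrite -(fineK (sqtail_fin (m k) a0)) lee_fin.
have mcD k : measurable_fun [set: T] (fun t => (cmod (D k t))%:E).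
  by apply/measurable_EFinP; exact: measurable_cmod.
(* By monotone convergence the integral of the sum is the sum of L1 norms, each at most a fixed
   multiple of $2^{-k}$. Hence the increments are absolutely summable almost everywhere. *)
have iD : (\int[mu]_t (\sum_(k <oo) (cmod (D k t))%:E) < +oo)%E.
  rewrite integral_nneseries//; last by move=> k t _; rewrite lee_fin cmod_ge0.
  apply: (@le_lt_trans _ _ (\sum_(k <oo) ((fine (mu setT) + 1) * 2 ^- k)%:E)%E).
    apply: lee_nneseries => k *; last exact: integral_cmod_le.
    by apply: integral_ge0 => t _; rewrite lee_fin cmod_ge0.
  have c0 : 0 <= fine (mu setT) + 1 by rewrite addr_ge0// fine_ge0.
  under eq_eseriesr do rewrite EFinM.
  rewrite nneseriesZl; last by move=> k _; rewrite lee_fin invr_ge0 exprn_ge0.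
  rewrite lte_mul_pinfty ?lee_fin//.
  apply: (@le_lt_trans _ _ 2%:E); last exact: ltry.
  apply: lime_le.
    by apply: is_cvg_nneseries => k _ _; rewrite lee_fin invr_ge0 exprn_ge0.
  apply: nearW => n; rewrite sumEFin lee_fin big_mkord.
  have -> : \sum_(i < n) 2 ^- i = 2 * \sum_(i < n) (2 ^+ i.+1 : R)^-1.
    rewrite mulr_sumr; apply: eq_bigr => i _.
    by rewrite exprS invfM mulrA mulfV ?mul1r.
  rewrite sum_geo_half ler_piMr// gerBl invr_ge0 exprn_ge0//.
have aeD : {ae mu, forall t, cvgn (series (fun k => cmod (D k t)))}.
  have : mu.-integrable setT (fun t => \sum_(k <oo) (cmod (D k t))%:E)%E.
    apply/integrableP; split.
      by apply: ge0_emeasurable_sum => // k t _ _; rewrite lee_fin cmod_ge0.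
    under eq_integral => t _.
      rewrite gee0_abs; last by apply: nneseries_ge0 => k _ _; rewrite lee_fin cmod_ge0.
      over.
    exact: iD.
  move/(integrable_ae measurableT); apply: filterS => t /(_ I) fin.
  apply: nnseries_is_cvg; first by move=> k; exact: cmod_ge0.
  by rewrite ltey_eq fin.
(* Upper limits make [f] defined and measurable everywhere; they agree with the limit wherever the
   subsequence converges. *)
pose f t := fine (limn_esup (fun k => (complex.Re (S k t))%:E)) +i*
            fine (limn_esup (fun k => (complex.Im (S k t))%:E)).
have mf : cmeasurable f.
  split; apply: (measurableT_comp (fine_measurable measurableT));
    apply: measurable_fun_limn_esup => k; apply/measurable_EFinP; [exact: (mSk k).1|exact: (mSk k).2].
have cvg_series (v u : nat -> R) : (forall k, `|v k.+1 - v k| <= u k) ->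
    cvgn (series u) -> cvgn v.
  move=> vu cu; have vE k : v k = v 0%N + series (telescope v) k.
    by rewrite telescopeK /= addrC subrK.
  rewrite (_ : v = fun k => v 0%N + series (telescope v) k); last exact/funext.
  apply: is_cvgD; first exact: is_cvg_cst.
  apply: normed_cvg; apply: (series_le_cvg _ _ _ cu) => k.
  - exact: normr_ge0.
  - by rewrite (le_trans _ (vu k)).
  - exact: vu.
have fS : {ae mu, forall t, S k t @[k --> \oo] --> f t}.
  apply: filterS aeD => t ct; apply: cvg_complex.
    have cR : cvgn (fun k => complex.Re (S k t)).
      apply: (cvg_series _ _ _ ct) => k.
      by rewrite -ReB (le_trans (Re_le_cmod _)).
    suff -> : complex.Re (f t) = limn (fun k => complex.Re (S k t)) by exact: cR.
    rewrite /f/=.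
    have /cvg_limn_einf_sup[_ ->] : (complex.Re (S k t))%:E @[k --> \oo] -->
        (limn (fun k => complex.Re (S k t)))%:E.
      by apply: cvg_EFin => //; exact: nearW.
    by [].
  have cR : cvgn (fun k => complex.Im (S k t)).
    apply: (cvg_series _ _ _ ct) => k.
    by rewrite -ImB (le_trans (Im_le_cmod _)).
  suff -> : complex.Im (f t) = limn (fun k => complex.Im (S k t)) by exact: cR.
  rewrite /f/=.
  have /cvg_limn_einf_sup[_ ->] : (complex.Im (S k t))%:E @[k --> \oo] -->
      (limn (fun k => complex.Im (S k t)))%:E.
    by apply: cvg_EFin => //; exact: nearW.
  by [].
exists f; split => // n.
(* The shift by [n] ensures that every partial sum involved has at least [n] terms, so the tail
   bound holds for all [k]. *)
pose G k t := (cmod (S (k + n)%N t - partial_sum w a n t) ^+ 2)%:E.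
have mps := cmeasurable_partial_sum mw a n.
have mG k : measurable_fun [set: T] (G k).
  by apply: measurable_cmod_sqr; exact: cmeasurableB.
have -> : (L2sq mu (fun t => f t - partial_sum w a n t)%R =
    \int[mu]_t limn_einf (G ^~ t))%E.
  apply: ae_eq_integral => //.
  - by apply: measurable_cmod_sqr; exact: cmeasurableB.
  - rewrite (_ : (fun t => limn_einf _) =
        (fun t => - limn_esup (fun k => - G k t))%E); last first.
      apply/funext => t; rewrite -limn_einfN; congr limn_einf.
      by apply/funext => k; rewrite /comp oppeK.
    apply: measurableT_comp => //; apply: measurable_fun_limn_esup => k.
    exact: measurableT_comp.
  - apply: filterS fS => t ft _; apply/esym.
    have /cvg_limn_einf_sup[-> _] // : G k t @[k --> \oo] -->
      (cmod (f t - partial_sum w a n t) ^+ 2)%:E.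
    apply: cvg_EFin; first exact: nearW.
    rewrite /G /comp/=.
    have ft' : S (k + n)%N t @[k --> \oo] --> f t.
      by move: ft; rewrite -(cvg_shiftn n).
    have c : cmod (S (k + n)%N t - partial_sum w a n t) @[k --> \oo] -->
        cmod (f t - partial_sum w a n t).
      by apply: cvg_cmod; apply: cvgB; [exact: ft'|exact: cvg_cst].
    exact: (cvgM c c).
apply: (le_trans (fatou _ _ _ _)) => //.
  by move=> k t _; rewrite lee_fin sqr_ge0.
apply: (le_trans (limn_einf_sup _)).
rewrite limn_esup_lim; apply: lime_le; first exact: is_cvg_esups.
apply: nearW => k; apply: ge_ereal_sup => _ [i /= ki <-].
have nm : (n <= m (i + n))%N by rewrite (leq_trans _ (mk _))// leq_addl.
rewrite -[leLHS]/(L2sq mu (fun t => S (i + n)%N t - partial_sum w a n t)).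
rewrite (L2sq_partial_sumB mufin mw bw ow _ nm).
exact: sqtail_ge.
Qed.

End RieszFischer.

(** * Isometries defined on l2 *)

Section Ell2Coefficients.
Variable R : realType.
Implicit Types (x y : ell2 R) (j n : nat).

(** Odd indices enumerate the positive integers, even ones the others. This turns square sums over
    the integers into series over [nat]. *)
Lemma lseq_bij : set_bij [set: nat] [set: int] lseq.
Proof.
split => //.
- move=> i j _ _; rewrite /lseq => e.
  have := odd_double_half i; have := odd_double_half j.
  by move: e; rewrite !uphalf_half; case: (odd i); case: (odd j) => /=; lia.
- move=> l _; case: (intP l) => [|k|k].
  + by exists 0%N.
  + by exists k.*2.+1 => //=; rewrite /lseq/= odd_double/= doubleK.
  + by exists k.+1.*2 => //=; rewrite /lseq/= odd_double/= doubleK.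
Qed.

Definition coef x j : R[i] := x (lseq j).

Lemma sqsum_coef x : sqsum x = sqtail (coef x) 0.
Proof.
rewrite /sqsum (@reindex_esum _ _ _ _ _ _ (fun l => (cmod (x l) ^+ 2)%:E) lseq_bij).
by rewrite /sqtail nneseries_esumT// => j; rewrite lee_fin sqr_ge0.
Qed.

Lemma sqsum_fin x : (sqtail (coef x) 0 < +oo)%E.
Proof. by rewrite -sqsum_coef; have := valP x; rewrite unfold_in. Qed.

Lemma coefD x y j : coef (x + y) j = coef x j + coef y j.
Proof. by []. Qed.

Lemma coefZ (a : R[i]) x j : coef (a *: x) j = a * coef x j.
Proof. by []. Qed.

Lemma lseq_inj : injective lseq.
Proof. by move=> i j; apply: (set_bij_inj lseq_bij); rewrite in_setT. Qed.

Lemma coef_gvec i j : coef (gvec R (lseq i)) j = (j == i)%:R.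
Proof. by rewrite /coef /= (inj_eq lseq_inj). Qed.

Definition trunc_ell2 n x : ell2 R :=
  \sum_(0 <= j < n) coef x j *: gvec R (lseq j).

Lemma coef_sum (I : Type) (s : seq I) (F : I -> ell2 R) j :
  coef (\sum_(i <- s) F i) j = \sum_(i <- s) coef (F i) j.
Proof. by rewrite (big_morph (coef^~ j) (id1 := 0) (op1 := +%R)). Qed.

Lemma coef_trunc n x j : coef (trunc_ell2 n x) j = if (j < n)%N then coef x j else 0.
Proof.
rewrite /trunc_ell2 coef_sum; under eq_bigr do rewrite coefZ coef_gvec.
rewrite big_mkord; case: ifPn => [jn|/negP jn].
  rewrite (bigD1 (Ordinal jn))//= eqxx mulr1 big1 ?addr0// => i ij.
  suff /negbTE -> : j != i by rewrite mulr0.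
  by apply: contra ij => /eqP ji; apply/eqP/val_inj.
rewrite big1// => i _; suff /negbTE -> : j != i by rewrite mulr0.
by apply/eqP => ji; apply: jn; rewrite ji.
Qed.

Lemma sqsum_trunc n x : sqsum (x - trunc_ell2 n x) = sqtail (coef x) n.
Proof.
have cE j : coef (x - trunc_ell2 n x) j = if (j < n)%N then 0 else coef x j.
  rewrite coefD -[coef (- _) j]/(- coef (trunc_ell2 n x) j) coef_trunc.
  by case: ifP => _; rewrite ?subrr ?subr0.
rewrite sqsum_coef (sqtail_split _ n) big_nat big1 ?add0e; last first.
  by move=> j /andP[_ jn]; rewrite cE jn [cmod _]Normc.normc0 expr0n.
have sq0 (b : nat -> R[i]) j : (0 <= (cmod (b j) ^+ 2)%:E)%E.
  by rewrite lee_fin sqr_ge0.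
rewrite /sqtail -(nneseries_addn n (sq0 _)) -(nneseries_addn n (sq0 (coef x))).
by apply: eq_eseriesr => j _; rewrite cE ltnNge leq_addl.
Qed.

(** Continuity of [shiftA]: translations preserve the square sum. The constant 2 is crude, but a
    finite constant is all that the density argument asks for. *)
Lemma sqsum_shiftA x : (sqsum (shiftA x) <= sqsum x + sqsum x)%E.
Proof.
have sqT s : \esum_(l in [set: int]) (cmod (x (l - s)) ^+ 2)%:E = sqsum x.
  rewrite /sqsum [RHS](@reindex_esum _ _ _ [set: int] [set: int] (fun l => l - s))//.
  split=> //; first by move=> a b _ _ /= /addIr.
  by move=> a _; exists (a + s) => //=; rewrite addrK.
rewrite -{1}(sqT 1) -(sqT (- 1)) -esumD; last 2 first.
- by move=> l _; rewrite lee_fin sqr_ge0.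
- by move=> l _; rewrite lee_fin sqr_ge0.
apply: le_esum => l _; rewrite -EFinD lee_fin.
rewrite -[shiftA x l]/(2^-1 * (x (l - 1) + x (l - - 1))).
rewrite (_ : 2^-1 = (2^-1 : R)%:C); last by rewrite fmorphV rmorph_nat.
rewrite cmodM cmod_real exprMn.
have := cmod_sqrD (x (l - 1)) (x (l - - 1)) (@ltr01 R).
rewrite invr1 ger0_norm ?invr_ge0//.
have := sqr_ge0 (cmod (x (l - 1))); have := sqr_ge0 (cmod (x (l - - 1))).
move: (cmod (x (l - 1)) ^+ 2) (cmod (x (l - - 1)) ^+ 2) (cmod _ ^+ 2) => a b c.
by move=> ? ? ?; rewrite expr2; lra.
Qed.

Lemma shiftA_linear (a : R[i]) x y : shiftA (a *: x + y) = a *: shiftA x + shiftA y.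
Proof.
apply: val_inj; apply/funext => l.
rewrite -[LHS]/(2^-1 * ((a * x (l - 1) + y (l - 1)) + (a * x (l - - 1) + y (l - - 1)))).
rewrite -[RHS]/(a * (2^-1 * (x (l - 1) + x (l - - 1))) + 2^-1 * (y (l - 1) + y (l - - 1))).
ring.
Qed.

End Ell2Coefficients.

(** * Properties of isometries that are linear almost everywhere *)

Section LinearIsometry.
Variables (R : realType) (d : measure_display) (T : measurableType d).
Variable mu : {measure set T -> \bar R}.
Implicit Types (x y z : ell2 R).

Lemma in_L2_cmeasurable (f : T -> R[i]) : in_L2 mu f -> cmeasurable f.
Proof. by case. Qed.

(** The norms are square roots of [fine] values, so their equality says something about the extended
    squares only because both of these are finite. *)
Lemma isometry_L2sq (U : ell2 R -> T -> R[i]) : linear_isometry mu U ->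
  forall z, L2sq mu (U z) = sqsum z.
Proof.
move=> [UL2 _ Uiso] z; have [_ _ Ufin] := UL2 z; have := Uiso z.
have zfin := sqsum_fin z; rewrite -sqsum_coef in zfin.
have Uf : L2sq mu (U z) \is a fin_num by rewrite ge0_fin_numE// L2sq_ge0.
have z0 : (0 <= sqsum z)%E by rewrite sqsum_coef sqtail_ge0.
have zf : sqsum z \is a fin_num by rewrite ge0_fin_numE.
rewrite /L2norm /ell2norm => /eqP; rewrite eqr_sqrt ?fine_ge0 ?L2sq_ge0// => /eqP e.
by rewrite -(fineK Uf) e fineK.
Qed.

Lemma isometry0 (U : ell2 R -> T -> R[i]) : linear_isometry mu U ->
  {ae mu, forall t, U 0 t = 0}.
Proof.
move=> [_ Ulin _]; have := Ulin 1 0 0; apply: filterS => t.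
by rewrite scaler0 addr0 mul1r => /eqP; rewrite -{1}[U 0 t]addr0 (inj_eq (addrI _)) eq_sym => /eqP.
Qed.

(** The defect [D] is linear almost everywhere and vanishes on basis vectors, so [x] may be replaced
    by its truncation error without changing [D x]. Continuity of [shiftA] and the bound on [m] then
    make its norm as small as a tail. *)
Lemma multiplication_by_density (U : ell2 R -> T -> R[i]) (m : T -> R[i]) (C : R) :
  linear_isometry mu U -> cmeasurable m -> (forall t, cmod (m t) <= C) ->
  (forall j, {ae mu, forall t, U (shiftA (gvec R (lseq j))) t =
                               m t * U (gvec R (lseq j)) t}) ->
  forall x, {ae mu, forall t, U (shiftA x) t = m t * U x t}.
Proof.
move=> UI mm mC Ug x; have [UL2 Ulin _] := UI.
have mU z : cmeasurable (U z) by exact: in_L2_cmeasurable.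
pose D z t := U (shiftA z) t - m t * U z t.
have mD z : cmeasurable (D z) by apply: cmeasurableB => //; exact: cmeasurableM.
have Dlin a y z : {ae mu, forall t, D (a *: y + z) t = a * D y t + D z t}.
  have l1 := Ulin a y z; have l2 := Ulin a (shiftA y) (shiftA z).
  apply: filterS2 l1 l2 => t e1 e2; rewrite /D shiftA_linear e1 e2; ring.
have D0 : {ae mu, forall t, D 0 t = 0}.
  have := Dlin 1 0 0; apply: filterS => t.
  by rewrite scaler0 addr0 mul1r => /eqP; rewrite -{1}[D 0 t]addr0 (inj_eq (addrI _)) eq_sym => /eqP.
have Dtrunc n : {ae mu, forall t, D (trunc_ell2 n x) t = 0}.
  rewrite /trunc_ell2; elim: n => [|n IH]; first by rewrite big_nil.
  rewrite big_nat_recr//= addrC.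
  have l := Dlin (coef x n) (gvec R (lseq n)) (\sum_(0 <= j < n) coef x j *: gvec R (lseq j)).
  apply: filterS3 l IH (Ug n) => t -> -> e.
  by rewrite addr0 /D e subrr mulr0.
suff : L2sq mu (D x) = 0%E.
  move/(L2sq_eq0 (mD x)); apply: filterS => t /eqP; rewrite subr_eq0 => /eqP //.
(* The 4 is the factor 2 from splitting the difference times the constant 2 of [sqsum_shiftA]; the
   other term comes from $|m|\le C$. *)
pose K := 4 + 2 * C ^+ 2.
apply: (@ge0_le_cvg0 _ _ (fun n => K * fine (sqtail (coef x) n))).
- exact: L2sq_ge0.
- move=> n; have tf := sqtail_fin n (sqsum_fin x).
  pose y := x - trunc_ell2 n x.
  have -> : L2sq mu (D x) = L2sq mu (D y).
    apply: L2sq_ae_eq => //; have := Dlin 1 y (trunc_ell2 n x).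
    rewrite scale1r subrK; apply: filterS2 (Dtrunc n) => t -> ->.
    by rewrite mul1r addr0.
  have sy : sqsum y = (fine (sqtail (coef x) n))%:E by rewrite sqsum_trunc fineK.
  apply: (@le_trans _ _ (2%:E * L2sq mu (U (shiftA y)) + (2 * C ^+ 2)%:E * L2sq mu (U y))%E).
    apply: L2sq_le_comb => //; first by rewrite mulr_ge0// sqr_ge0.
    move=> t; have := cmod_sqrD (U (shiftA y) t) (- (m t * U y t)) (@ltr01 R).
    rewrite invr1 (_ : 1 + 1 = 2)// => /le_trans; apply; rewrite lerD2l.
    have -> : cmod (- (m t * U y t)) = cmod (m t) * cmod (U y t).
      by rewrite -cmodM; case: (_ * _) => a b; rewrite /= !sqrrN.
    rewrite exprMn mulrA ler_wpM2r ?sqr_ge0// ler_wpM2l//.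
    by rewrite lerXn2r// nnegrE ?cmod_ge0// (le_trans (cmod_ge0 _) (mC t)).
  rewrite !isometry_L2sq//.
  apply: (@le_trans _ _ (2%:E * (sqsum y + sqsum y) + (2 * C ^+ 2)%:E * sqsum y)%E).
    by apply: leeD => //; apply: lee_wpmul2l; [rewrite lee_fin|exact: sqsum_shiftA].
  by rewrite sy -EFinD lee_fin /K le_eqVlt; apply/orP; left; apply/eqP; ring.
- suff : K * fine (sqtail (coef x) n) @[n --> \oo] --> K * 0 by rewrite mulr0.
  by apply: cvgM; [exact: cvg_cst|exact: sqtail_cvg0 (sqsum_fin x)].
Qed.

End LinearIsometry.

Section IsometryFromOrthonormal.
Variables (R : realType) (d : measure_display) (T : measurableType d).
Variable mu : {measure set T -> \bar R}.
Hypothesis mufin : (mu setT < +oo)%E.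
Variables (w : nat -> T -> R[i]) (B : nat -> R).
Hypothesis mw : forall j, cmeasurable (w j).
Hypothesis bw : forall j t, cmod (w j t) <= B j.
Hypothesis ow : forall i j,
  cintegral mu (fun t => w i t * (w j t)^*) = (i == j)%:R.

Lemma ler_lime (x y : R) : 0 <= y -> (forall e, 0 < e -> x <= (1 + e) * y) -> x <= y.
Proof.
move=> y0 H; rewrite leNgt; apply/negP => yx.
(* This [e] makes $ey<x-y$; the added 1 covers the case $y=0$. *)
have e0 : 0 < (x - y) / (y + 1) by rewrite divr_gt0 ?subr_gt0// ltr_wpDl.
have := H _ e0; rewrite mulrDl mul1r -lerBlDl leNgt => /negP; apply.
by rewrite -mulrA gtr_pMr ?subr_gt0// mulrC ltr_pdivrMr ?ltr_wpDl// mul1r ltrDl.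
Qed.

(** With $S_n$ the partial sum, the weighted inequality is applied to $f=S_n+(f-S_n)$ and to
    $S_n=f-(f-S_n)$. Letting [n] grow and then [e] shrink gives the two inequalities. *)
Lemma L2sq_limit (f : T -> R[i]) (a : nat -> R[i]) : (sqtail a 0 < +oo)%E ->
  cmeasurable f ->
  (forall n, (L2sq mu (fun t => f t - partial_sum w a n t)%R <= sqtail a n)%E) ->
  L2sq mu f = sqtail a 0.
Proof.
move=> a0 mf fa.
pose s n := \sum_(0 <= j < n) cmod (a j) ^+ 2; pose r n := fine (sqtail a n).
have rE n : sqtail a n = (r n)%:E by rewrite fineK// sqtail_fin.
have r0 : r n @[n --> \oo] --> (0 : R) by exact: sqtail_cvg0.
have sE n : s n = r 0%N - r n.
  by have := sqtail_split a n; rewrite !rE -/(s n) => -[->]; rewrite addrK.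
have mS := cmeasurable_partial_sum mw a.
have LS n : L2sq mu (partial_sum w a n) = (s n)%:E.
  by rewrite -(L2sq_orthonormal_sum mufin mw bw ow) ?iota_uniq.
have fS e n : 0 < e ->
    (L2sq mu f <= (1 + e)%:E * (s n)%:E + (1 + e^-1)%:E * (r n)%:E)%E.
  move=> e0; apply: (@le_trans _ _ ((1 + e)%:E * L2sq mu (partial_sum w a n) +
    (1 + e^-1)%:E * L2sq mu (fun t => f t - partial_sum w a n t)%R)%E).
    apply: L2sq_le_comb => //.
    - by rewrite addr_ge0// ltW.
    - by rewrite addr_ge0// invr_ge0 ltW.
    - exact: cmeasurableB.
    - move=> t; have := cmod_sqrD (partial_sum w a n t) (f t - partial_sum w a n t) e0.
      by rewrite addrC subrK.
  rewrite LS leeD2l// lee_wpmul2l// ?lee_fin ?addr_ge0 ?invr_ge0 ?(ltW e0)//.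
  by rewrite -rE.
have Lfin : L2sq mu f \is a fin_num.
  rewrite ge0_fin_numE ?L2sq_ge0// (le_lt_trans (fS 1 0%N ltr01))//.
  by rewrite -!EFinM -EFinD ltry.
have Sf e n : 0 < e -> s n <= (1 + e) * fine (L2sq mu f) + (1 + e^-1) * r n.
  move=> e0; rewrite -lee_fin -LS EFinD !EFinM fineK//.
  apply: (@le_trans _ _ ((1 + e)%:E * L2sq mu f +
    (1 + e^-1)%:E * L2sq mu (fun t => f t - partial_sum w a n t)%R)%E).
    apply: L2sq_le_comb => //.
    - by rewrite addr_ge0// ltW.
    - by rewrite addr_ge0// invr_ge0 ltW.
    - exact: cmeasurableB.
    - move=> t; have := cmod_sqrD (f t) (- (f t - partial_sum w a n t)) e0.
      rewrite opprB addrC subrK => /le_trans; apply; rewrite lerD2l.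
      by rewrite -opprB; case: (_ - _) => x y; rewrite /= !sqrrN.
  by rewrite leeD2l// lee_wpmul2l// ?lee_fin ?addr_ge0 ?invr_ge0 ?(ltW e0)// -rE.
have cs : s n @[n --> \oo] --> r 0%N.
  rewrite (_ : s = fun n => r 0%N - r n); last exact/funext.
  suff : r 0%N - r n @[n --> \oo] --> r 0%N - 0 by rewrite subr0.
  by apply: cvgB => //; exact: cvg_cst.
have x0 : 0 <= fine (L2sq mu f) by rewrite fine_ge0// L2sq_ge0.
have r00 : 0 <= r 0%N by rewrite fine_ge0// sqtail_ge0.
rewrite rE -(fineK Lfin); congr EFin; apply/eqP; rewrite eq_le; apply/andP; split.
  apply: ler_lime => // e e0.
  have c : (1 + e) * s n + (1 + e^-1) * r n @[n --> \oo] -->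
      (1 + e) * r 0%N + (1 + e^-1) * 0.
    by apply: cvgD; apply: cvgM => //; exact: cvg_cst.
  rewrite mulr0 addr0 in c; apply: (cvgr_to_ge c); apply: nearW => n.
  by rewrite -lee_fin fineK// EFinD !EFinM fS.
apply: ler_lime => // e e0.
have c : (1 + e) * fine (L2sq mu f) + (1 + e^-1) * r n - s n @[n --> \oo] -->
    (1 + e) * fine (L2sq mu f) + (1 + e^-1) * 0 - r 0%N.
  apply: cvgB => //; apply: cvgD; first exact: cvg_cst.
  by apply: cvgM => //; exact: cvg_cst.
rewrite mulr0 addr0 in c; rewrite -subr_ge0; apply: (cvgr_to_ge c).
by apply: nearW => n; rewrite subr_ge0 Sf.
Qed.

Lemma orthonormal_isometry : exists U : ell2 R -> T -> R[i],
  linear_isometry mu U /\ forall j, {ae mu, forall t, U (gvec R (lseq j)) t = w j t}.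
Proof.
have /choice[U UP] z := riesz_fischer mufin mw bw ow (sqsum_fin z).
have mU z : cmeasurable (U z) by case: (UP z).
have LU z : L2sq mu (U z) = sqsum z.
  by rewrite sqsum_coef; apply: L2sq_limit; [exact: sqsum_fin|exact: mU|case: (UP z)].
exists U; split; first split.
- move=> z; split; [exact: (mU z).1|exact: (mU z).2|].
  by rewrite LU sqsum_coef sqsum_fin.
- move=> a x y.
  pose P := partial_sum w; have mP := cmeasurable_partial_sum mw.
  pose E z n t := U z t - P (coef z) n t.
  have mE z n : cmeasurable (E z n) by exact: cmeasurableB.
  pose D t := U (a *: x + y) t - (a * U x t + U y t).
  have maE z n : cmeasurable (fun t => a * E z n t).
    by apply: cmeasurableM => //; exact: cmeasurable_cst.
  have mD : cmeasurable D.
    apply: cmeasurableB => //; apply: cmeasurableD => //.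
    by apply: cmeasurableM => //; exact: cmeasurable_cst.
  pose r (z : ell2 R) n := fine (sqtail (coef z) n).
  have LE z n : (L2sq mu (E z n) <= (r z n)%:E)%E.
    have [_ h] := UP z; rewrite /r fineK; first exact: h.
    exact: sqtail_fin (sqsum_fin z).
  suff : L2sq mu D = 0%E.
    by move/(L2sq_eq0 mD); apply: filterS => t /eqP; rewrite subr_eq0 => /eqP.
  pose v n := 2 * r (a *: x + y) n + 2 * (2 * (cmod a ^+ 2 * r x n) + 2 * r y n).
  apply: (@ge0_le_cvg0 _ _ v); first exact: L2sq_ge0.
    move=> n.
    pose F t := - (a * E x n t + E y n t).
    have mF : cmeasurable F.
      rewrite /F; under eq_fun do rewrite -sub0r.
      by apply: cmeasurableB; [exact: cmeasurable_cst|exact: cmeasurableD].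
    (* Partial sums are exactly linear in the coefficients, so they cancel and only the
       approximation errors remain, for every [n]. *)
    have -> : D = (fun t => E (a *: x + y) n t + F t).
      apply/funext => t; rewrite /D /F /E /P /partial_sum.
      have -> : \sum_(0 <= j < n) coef (a *: x + y) j * w j t =
        a * \sum_(0 <= j < n) coef x j * w j t + \sum_(0 <= j < n) coef y j * w j t.
        rewrite mulr_sumr -big_split; apply: eq_bigr => j _.
        rewrite [LHS](_ : _ = (a * coef x j + coef y j) * w j t)//.
        by rewrite mulrDl mulrA.
      ring.
    apply: (le_trans (L2sqD_le _ (mE _ _) mF)).
    rewrite -[leRHS]/(2%:E * (r (a *: x + y)%R n)%:E +
      2%:E * (2 * (cmod a ^+ 2 * r x n) + 2 * r y n)%:E)%E; apply: leeD.
      by apply: lee_wpmul2l; rewrite ?lee_fin.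
    apply: lee_wpmul2l; first by rewrite lee_fin.
    have -> : L2sq mu F = L2sq mu (fun t => a * E x n t + E y n t).
      apply: eq_integral => t _; rewrite /F.
      by case: (_ + _) => b c; rewrite /= !sqrrN.
    apply: (le_trans (L2sqD_le _ (maE _ _) (mE _ _))).
    rewrite -[leRHS]/(2%:E * ((cmod a ^+ 2)%:E * (r x n)%:E) + 2%:E * (r y n)%:E)%E.
    apply: leeD; apply: lee_wpmul2l; rewrite ?lee_fin//.
    by rewrite L2sqZ// lee_wpmul2l// lee_fin sqr_ge0.
  have c z : r z n @[n --> \oo] --> (0 : R) by exact: sqtail_cvg0 (sqsum_fin z).
  have : v n @[n --> \oo] --> 2 * 0 + 2 * (2 * (cmod a ^+ 2 * 0) + 2 * 0).
    apply: cvgD; apply: cvgM; first exact: cvg_cst.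
    - exact: c.
    - exact: cvg_cst.
    apply: cvgD; apply: cvgM; first exact: cvg_cst.
    - by apply: cvgM; [exact: cvg_cst|exact: c].
    - exact: cvg_cst.
    - exact: c.
  by rewrite !mulr0 addr0 mulr0 addr0.
- by move=> z; rewrite /L2norm LU.
(* A basis vector has no coefficient beyond index [j], so the tail after [j.+1] terms is 0 and its
   image equals that partial sum almost everywhere. *)
- move=> j; have [_ /(_ j.+1)] := UP (gvec R (lseq j)).
  have t0 : sqtail (coef (gvec R (lseq j))) j.+1 = 0%E.
    rewrite /sqtail -(nneseries_addn j.+1) => [|i]; last by rewrite lee_fin sqr_ge0.
    apply: eseries0 => i _ _; rewrite coef_gvec gtn_eqF ?leq_addl//.
    by rewrite [cmod _]Normc.normc0 expr0n.
  rewrite t0 => le0.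
  have mS := cmeasurable_partial_sum mw (coef (gvec R (lseq j))) j.+1.
  have L0 : L2sq mu (fun t => U (gvec R (lseq j)) t -
      partial_sum w (coef (gvec R (lseq j))) j.+1 t) = 0%E.
    by apply/eqP; rewrite eq_le le0 L2sq_ge0.
  move: (L2sq_eq0 (cmeasurableB (mU (gvec R (lseq j))) mS) L0).
  apply: filterS => t /eqP; rewrite subr_eq0 => /eqP ->.
  rewrite /partial_sum big_nat_recr// coef_gvec eqxx mul1r.
  rewrite big_nat big1 => [|i /andP[_ ij]]; first exact: add0r.
  by rewrite coef_gvec ltn_eqF// mul0r.
Qed.

End IsometryFromOrthonormal.

(** * The limit space *)

Section Fourier.
Variable R : realType.

Lemma expi_2pi (l : int) : expi (2 * pi * l%:~R) = 1 :> R[i].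
Proof.
rewrite mulrC -expiX (_ : expi (2 * pi) = 1) ?exp1rz//.
by rewrite /expi mulr_natl cos2pi sin2pi.
Qed.

Lemma integral_lebesgue01_derive (f F : R -> R) : continuous f ->
  (forall t : R, is_derive t 1 F (f t)) -> \int[lebesgue01 R]_t f t = F 1 - F 0.
Proof.
move=> cf dF; rewrite /Rintegral integral_lebesgue01; last first.
  by apply/measurable_EFinP; exact: continuous_measurable_fun.
have cF : continuous F.
  move=> t; apply: differentiable_continuous; apply/derivable1_diffP.
  by have [] := dF t.
rewrite (@continuous_FTC2 _ f F)//.
- exact: continuous_subspaceT.
- split.
  + by move=> t _; have [] := dF t.
  + by apply: cvg_at_right_filter; exact: cF.
  + by apply: cvg_at_left_filter; exact: cF.
- by move=> t _; rewrite derive1E; have [_] := dF t.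
Qed.

Lemma cintegral_expi (l : int) :
  cintegral (lebesgue01 R) (fun t => expi (2 * pi * l%:~R * t)) = (l == 0)%:R.
Proof.
have [->|l0] := eqVneq l 0.
  rewrite /cintegral /=; under eq_Rintegral do rewrite mulr0 mul0r cos0.
  under [X in _ +i* X]eq_Rintegral do rewrite mulr0 mul0r sin0.
  rewrite !Rintegral_cst// mul0r mul1r.
  by rewrite (_ : lebesgue01 R _ = 1%E) ?lebesgue01T.
pose c : R := 2 * pi * l%:~R.
have c0 : c != 0 by rewrite !mulf_neq0 ?pnatr_eq0 ?intr_eq0// gt_eqF// pi_gt0.
(* $\cos c=1$ and $\sin c=0$: the antiderivatives of both parts take equal values at 0 and 1. *)
have := expi_2pi l; rewrite -/c => -[cc sc].
have cl : continuous (fun t : R => c * t).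
  by move=> t; apply: cvgM; [exact: cvg_cst|exact: cvg_id].
have dc (t : R) : is_derive t 1 (fun u : R => c * u) c.
  by apply: is_derive_eq; rewrite /GRing.scale/= mulr1.
have Ic : \int[lebesgue01 R]_t cos (c * t) = 0.
  have ds (t : R) : is_derive t 1 (fun u : R => c^-1 * sin (c * u)) (cos (c * t)).
    have h := @is_derive1_comp _ (@sin R) (fun u : R => c * u) t _ _ (is_derive_sin _) (dc t).
    by apply: is_derive_eq; rewrite /GRing.scale/=; field.
  rewrite (integral_lebesgue01_derive _ ds); last first.
    by move=> t; apply: (@continuous_comp _ _ _ _ (@cos R)); [exact: cl|exact: continuous_cos].
  by rewrite mulr1 mulr0 sc sin0 subrr.
have Is : \int[lebesgue01 R]_t sin (c * t) = 0.
  have ds (t : R) : is_derive t 1 (fun u : R => - c^-1 * cos (c * u)) (sin (c * t)).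
    have h := @is_derive1_comp _ (@cos R) (fun u : R => c * u) t _ _ (is_derive_cos _) (dc t).
    by apply: is_derive_eq; rewrite /GRing.scale/=; field.
  rewrite (integral_lebesgue01_derive _ ds); last first.
    by move=> t; apply: (@continuous_comp _ _ _ _ (@sin R)); [exact: cl|exact: continuous_sin].
  by rewrite mulr1 mulr0 cc cos0 subrr.
by rewrite /cintegral/= Ic Is.
Qed.

End Fourier.

#[local] Instance lebesgue01_ae_filter (R : realType) :
  Filter (almost_everywhere (lebesgue01 R)).
Proof. exact: ae_filter_ringOfSetsType. Qed.

(** * Transfer between the cube and the unit interval *)

Section LimitSpace.
Variables (R : realType) (mu : probability (borelQ R) R).
Hypothesis muX : forall B : set (borelQ R), measurable B ->
  mu B = pushforward (lebesgue01 R) (@Xmap R) B.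

Lemma mu_fin : (mu setT < +oo)%E.
Proof. by rewrite probability_setT ltry. Qed.

Lemma ge0_integral_Xmap (f : borelQ R -> \bar R) :
  measurable_fun [set: borelQ R] f -> (forall q, 0 <= f q)%E ->
  (\int[mu]_q f q = \int[lebesgue01 R]_t f (Xmap t))%E.
Proof.
move=> mf f0; rewrite (@eq_measure_integral _ _ _ _ (@Xlaw R)); last first.
  by move=> A mA _; exact: muX.
by rewrite (ge0_integral_pushforward (@measurable_Xmap R)).
Qed.

Lemma L2sq_Xmap (f : borelQ R -> R[i]) : cmeasurable f ->
  L2sq mu f = L2sq (lebesgue01 R) (f \o @Xmap R).
Proof.
move=> mf; apply: ge0_integral_Xmap; first exact: measurable_cmod_sqr.
by move=> q; rewrite lee_fin sqr_ge0.
Qed.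

Lemma Rintegral_Xmap (g : borelQ R -> R) (M : R) :
  measurable_fun [set: borelQ R] g -> (forall q, `|g q| <= M) ->
  \int[mu]_q g q = \int[lebesgue01 R]_t g (Xmap t).
Proof.
move=> mg gM; rewrite /Rintegral; congr fine.
rewrite (@eq_measure_integral _ _ _ _ (@Xlaw R)); last by move=> A mA _; exact: muX.
rewrite -[RHS]/(\int[lebesgue01 R]_(t in (@Xmap R) @^-1` setT)
  ((EFin \o g) \o (@Xmap R)) t)%E.
rewrite -(integral_pushforward (@measurable_Xmap R))//.
  exact/measurable_EFinP.
rewrite preimage_setT -[X in integrable _ _ X]/(EFin \o (g \o @Xmap R)).
apply: measurable_bounded_integrable => //.
- by rewrite lebesgue01T ltry.
- by apply: (measurableT_comp mg); exact: measurable_Xmap.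
- exists M; split; first exact: num_real.
  by move=> x Mx t _; rewrite /= (le_trans (gM _))// ltW.
Qed.

Lemma cintegral_Xmap (f : borelQ R -> R[i]) (M : R) : cmeasurable f ->
  (forall q, cmod (f q) <= M) ->
  cintegral mu f = cintegral (lebesgue01 R) (f \o @Xmap R).
Proof.
move=> [fr fi] fM; rewrite /cintegral; congr (_ +i* _).
  apply: (@Rintegral_Xmap _ M) => // q.
  by rewrite (le_trans (Re_le_cmod _)).
apply: (@Rintegral_Xmap _ M) => // q.
by rewrite (le_trans (Im_le_cmod _)).
Qed.

Lemma cmeasurable_Xmap (f : borelQ R -> R[i]) : cmeasurable f ->
  cmeasurable (f \o @Xmap R : measurableTypeR R -> R[i]).
Proof.
by move=> [fr fi]; split; [apply: (measurableT_comp fr)|apply: (measurableT_comp fi)];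
  exact: measurable_Xmap.
Qed.

Lemma ae_Xmap (P : borelQ R -> Prop) : {ae mu, forall q, P q} ->
  {ae lebesgue01 R, forall t, P (Xmap t)}.
Proof.
move=> [N [mN N0 PN]]; exists ((@Xmap R) @^-1` N); split.
- by rewrite -[X in measurable X]setTI; exact: measurable_Xmap.
- by rewrite -[LHS]/(pushforward (lebesgue01 R) (@Xmap R) N) -muX.
- by move=> t /= nP; exact: PN.
Qed.

(** An exceptional set in $[0,1]$ need not be the preimage of a Borel set of the cube. For an
    equality the squared L2 norm of $f-g$ carries the information instead, since it can be computed
    on either side. *)
Lemma ae_eq_of_Xmap (f g : borelQ R -> R[i]) : cmeasurable f -> cmeasurable g ->
  {ae lebesgue01 R, forall t, f (Xmap t) = g (Xmap t)} ->
  {ae mu, forall q, f q = g q}.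
Proof.
move=> mf mg fg; have mfg := cmeasurableB mf mg.
suff : L2sq mu (fun q => f q - g q) = 0%E.
  by move/(L2sq_eq0 mfg); apply: filterS => q /eqP; rewrite subr_eq0 => /eqP.
rewrite L2sq_Xmap// (@L2sq_ae_eq _ _ _ _ _ (fun=> 0)).
- rewrite /L2sq; under eq_integral do rewrite [cmod _]Normc.normc0 expr0n.
  by rewrite integral0.
- exact: (cmeasurable_Xmap mfg).
- exact: cmeasurable_cst.
- by apply: filterS fg => t /= ->; rewrite subrr.
Qed.

Definition wQ (j : nat) (q : borelQ R) : R[i] :=
  Qproj j q / (Num.sqrt (c_lim R j))%:C.

Lemma cmeasurable_wQ j : cmeasurable (wQ j).
Proof.
apply: cmeasurableM; last exact: cmeasurable_cst.
split.
  apply: (@measurable_continuous_borelQ _ (@complex.Re R \o @Qproj R j)) => q.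
  by apply: continuous_comp; [exact: Qproj_continuous|exact: Re_continuous].
apply: (@measurable_continuous_borelQ _ (@complex.Im R \o @Qproj R j)) => q.
by apply: continuous_comp; [exact: Qproj_continuous|exact: Im_continuous].
Qed.

(** The modulus is 1 along the curve, but on the whole cube only $1/\sqrt{c_j}$ is available as a
    bound; it suffices for integrability. *)
Lemma cmod_wQ_le j q : cmod (wQ j q) <= cmod ((Num.sqrt (c_lim R j))%:C^-1).
Proof. by rewrite cmodM ler_piMl ?cmod_ge0// Qproj_le1. Qed.

Lemma wQ_Xmap j t : wQ j (Xmap t) = expi (2 * pi * (lseq j)%:~R * t).
Proof.
rewrite /wQ Qproj_Xmap /c_lim sqrt_exp2 mulrAC mulfV ?mul1r//.
by rewrite fmorph_eq0 invr_eq0 expf_neq0// sqrtr_eq0 -ltNge.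
Qed.

Lemma wQ_orthonormal i j :
  cintegral mu (fun q => wQ i q * (wQ j q)^*) = (i == j)%:R.
Proof.
pose C k := cmod ((Num.sqrt (c_lim R k))%:C^-1).
rewrite (@cintegral_Xmap _ (C i * C j)).
- rewrite (_ : _ \o _ = fun t => expi (2 * pi * (lseq i - lseq j)%:~R * t)).
    by rewrite cintegral_expi subr_eq0 (inj_eq lseq_inj).
  apply/funext => t /=; rewrite !wQ_Xmap.
  rewrite -[X in _ * X]/((expi _)^*) expi_conj -expiD; congr expi.
  by rewrite rmorphB/=; ring.
- apply: cmeasurableM; first exact: cmeasurable_wQ.
  exact/cmeasurable_conj/cmeasurable_wQ.
- by move=> q; rewrite cmodM cmod_conj ler_pM ?cmod_ge0 ?cmod_wQ_le.
Qed.

Lemma exists_Uhat : exists Uhat, is_Uhat mu (@e_lim R) (@c_lim R) Uhat.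
Proof.
exact: (orthonormal_isometry mu_fin cmeasurable_wQ cmod_wQ_le wQ_orthonormal).
Qed.

(** * Consequences for an arbitrary isometry [Uhat] *)

Section GivenUhat.
Variable Uhat : ell2 R -> borelQ R -> R[i].
Hypothesis UhatP : is_Uhat mu (@e_lim R) (@c_lim R) Uhat.

Lemma Uhat_Xmap_isometry :
  linear_isometry (lebesgue01 R) (fun z => Uhat z \o @Xmap R).
Proof.
have [[UL2 Ulin Uiso] _] := UhatP.
have mU z : cmeasurable (Uhat z) by exact: in_L2_cmeasurable (UL2 z).
split.
- move=> z; have [m1 m2] := cmeasurable_Xmap (mU z); split => //.
  by rewrite -L2sq_Xmap//; have [] := UL2 z.
- by move=> a x y; exact: ae_Xmap (Ulin a x y).
- by move=> z; rewrite -Uiso /L2norm -L2sq_Xmap.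
Qed.

Lemma Uhat_Xmap_gvec (l : int) :
  {ae lebesgue01 R, forall t, Uhat (gvec R l) (Xmap t) = expi (2 * pi * l%:~R * t)}.
Proof.
have [_ Ue] := UhatP; have [_ _ /(_ l I)[j _ <-]] := lseq_bij.
by apply: filterS (ae_Xmap (Ue j)) => t ->; exact: wQ_Xmap.
Qed.

Lemma Uhat_Xmap_shiftA_gvec (l : int) :
  {ae lebesgue01 R, forall t, Uhat (shiftA (gvec R l)) (Xmap t) =
    (cos (2 * pi * t))%:C * expi (2 * pi * l%:~R * t)}.
Proof.
have UI := Uhat_Xmap_isometry; have [_ Ulin _] := UI.
(* Linearity is given only in the form $ax+y$, so the pure scaling is taken with $y=0$, and the
   value at 0 is removed by [isometry0]. *)
have l1 := Ulin 2^-1 (gvec R (l + 1) + gvec R (l - 1)) 0.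
have l2 := Ulin 1 (gvec R (l + 1)) (gvec R (l - 1)).
have h1 := Uhat_Xmap_gvec (l + 1); have h2 := Uhat_Xmap_gvec (l - 1).
rewrite addr0 in l1; rewrite scale1r in l2.
have l12 : {ae lebesgue01 R, forall t,
    Uhat (2^-1 *: (gvec R (l + 1) + gvec R (l - 1))) (Xmap t) =
    2^-1 * (Uhat (gvec R (l + 1)) (Xmap t) + Uhat (gvec R (l - 1)) (Xmap t))}.
  by apply: filterS3 l1 l2 (isometry0 UI) => t /= -> -> ->; rewrite addr0 mul1r.
apply: filterS3 l12 h1 h2 => t + f1 f2.
rewrite f1 f2 /shiftA RS_gvec LS_gvec => ->.
have -> : 2 * pi * (l + 1)%:~R * t = 2 * pi * l%:~R * t + 2 * pi * t.
  by rewrite rmorphD/=; ring.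
have -> : 2 * pi * (l - 1)%:~R * t = 2 * pi * l%:~R * t - 2 * pi * t.
  by rewrite rmorphB/=; ring.
rewrite !expiD -mulrDr mulrCA mulrC; congr (_ * _).
rewrite (_ : 2^-1 = (2^-1 : R)%:C); last by rewrite fmorphV rmorph_nat.
apply/eqP; rewrite eq_complex Re_realM Im_realM ReD ImD/= cosN sinN subrr mulr0 eqxx andbT.
by apply/eqP; lra.
Qed.

Lemma exists_mhat : exists mhat, is_mhat mu (@shiftA R) Uhat mhat.
Proof.
have [UI _] := UhatP; have [UL2 _ _] := UI.
pose mhat q := complex.Re (wQ 1 q).
pose C := cmod ((Num.sqrt (c_lim R 1))%:C^-1).
have mm : cmeasurable (fun q => (mhat q)%:C).
  by split => /=; [exact: (cmeasurable_wQ 1).1|exact: measurable_cst].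
have mC q : cmod (mhat q)%:C <= C.
  by rewrite cmod_real (le_trans (Re_le_cmod _))// cmod_wQ_le.
have mX t : mhat (Xmap t) = cos (2 * pi * t).
  by rewrite /mhat wQ_Xmap (_ : lseq 1 = 1)//= mulr1.
exists mhat; split.
  have [m1 m2] := mm; split => //.
  apply: (@le_lt_trans _ _ (\int[mu]_q (C ^+ 2)%:E)%E).
    apply: ge0_le_integral => //.
    - by move=> q _; rewrite lee_fin sqr_ge0.
    - exact: measurable_cmod_sqr.
    - move=> q _; rewrite lee_fin lerXn2r// nnegrE ?cmod_ge0//.
  by rewrite integral_cst// lte_mul_pinfty ?lee_fin ?sqr_ge0// mu_fin.
apply: (multiplication_by_density UI mm mC) => j.
have mU z : cmeasurable (Uhat z) by exact: in_L2_cmeasurable (UL2 z).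
(* The identity on a basis vector is an addition formula on $[0,1]$; it is brought back to the cube
   as an equality of measurable functions. *)
apply: ae_eq_of_Xmap => //; first exact: cmeasurableM.
apply: filterS2 (Uhat_Xmap_shiftA_gvec (lseq j)) (Uhat_Xmap_gvec (lseq j)) => t -> ->.
by rewrite mX.
Qed.

(** One test vector determines any multiplier: the image of $g_0$ is the constant 1, so the
    multiplier is the image of $Ag_0$. *)
Lemma mhat_Xmap (mhat : borelQ R -> R) : is_mhat mu (@shiftA R) Uhat mhat ->
  {ae lebesgue01 R, forall t, mhat (Xmap t) = cos (2 * pi * t)}.
Proof.
move=> [_ mhatP].
apply: filterS3 (ae_Xmap (mhatP (gvec R 0))) (Uhat_Xmap_shiftA_gvec 0)
  (Uhat_Xmap_gvec 0) => t e1 e2 e3.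
move: e1; rewrite e2 e3 mulr0 mul0r expi0 !mulr1.
by move/(congr1 (@complex.Re R)).
Qed.

End GivenUhat.
End LimitSpace.

(** The limit measure, the isometry and the multiplier are characterized by predicates; each
    existence clause keeps the quantification over all such objects from being vacuous. *)
Theorem theorem7p1 (R : realType) :
  ss_convergent (@shift_seq R) /\
  (exists muhat, is_limit_measure (@shift_seq R) muhat) /\
  forall muhat : probability (borelQ R) R,
    is_limit_measure (@shift_seq R) muhat ->
    (forall B : set (borelQ R), measurable B ->
      muhat B = pushforward (lebesgue01 R) (@Xmap R) B) /\
    (exists Uhat, is_Uhat muhat (@e_lim R) (@c_lim R) Uhat) /\
    forall Uhat : ell2 R -> borelQ R -> R[i],
      is_Uhat muhat (@e_lim R) (@c_lim R) Uhat ->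
      let U z := Uhat z \o @Xmap R in
      linear_isometry (lebesgue01 R) U /\
      (forall l : int,
        {ae lebesgue01 R, forall t, U (gvec R l) t = expi (2 * pi * l%:~R * t)}) /\
      (exists mhat, is_mhat muhat (@shiftA R) Uhat mhat) /\
      forall mhat : borelQ R -> R,
        is_mhat muhat (@shiftA R) Uhat mhat ->
        let m := mhat \o @Xmap R in
        {ae lebesgue01 R, forall t, m t = cos (2 * pi * t)} /\
        forall z : ell2 R,
          {ae lebesgue01 R, forall t, U (shiftA z) t = (m t)%:C * U z t}.
Proof.
split; first by move=> h ch; exact: cvgP (ss_integral_cvg ch).
split; first by exists (@Xlaw R); exact: is_limit_measure_Xlaw.
move=> muhat muP; have muX := limit_measure_unique muP.
split; first exact: muX.
split; first exact: exists_Uhat.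
move=> Uhat UP U; split; first exact: Uhat_Xmap_isometry UP.
split; first by move=> l; exact: Uhat_Xmap_gvec UP l.
split; first exact: exists_mhat UP.
move=> mhat mP m; split; first exact: mhat_Xmap UP _ mP.
by move=> z; have [_ h] := mP; exact: (ae_Xmap muX (h z)).
Qed.
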